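(* Let $\mathbb{F}=\mathbb{R}$ or $\mathbb{C}$, let $0<r<m$ be integers, and let $P$ be a Borel probability measure on the Grassmannian $\mathrm{G}(m,r)$ of $r$-dimensional linear subspaces of $\mathbb{F}^m$. Then $P$ has a unique Grassmannian maximum likelihood estimate (GE) if and only if $$\int_{\mathrm{G}(m,r)}\dim(U\cap V)\,dP(U)<\frac rm\dim(V)$$ for all nontrivial linear subspaces $V$ of $\mathbb{F}^m$ (i.e. $0\ne V\ne\mathbb{F}^m$).
   Context: Dimensions are over $\mathbb{F}$, and $A^*$ denotes the adjoint (transpose if $\mathbb{F}=\mathbb{R}$, conjugate transpose if $\mathbb{F}=\mathbb{C}$) of a matrix $A$. $\mathrm{Pos}(m)$ is the set of positive definite self-adjoint matrices $\Sigma\in\mathbb{F}^{m\times m}$ with $\det\Sigma=1$. For $\Sigma\in\mathrm{Pos}(m)$, the Grassmannian distribution $\mathcal{G}_\Sigma$ is the law on $\mathrm{G}(m,r)$ of the linear span of $r$ i.i.d. centered normal vectors in $\mathbb{F}^m$ with covariance matrix $\Sigma$ (circularly symmetric if $\mathbb{F}=\mathbb{C}$); $\mathcal{G}_I$ is the uniform distribution. For $U=\langle X\rangle$ the range of a matrix $X\in\mathbb{F}^{m\times r}$ of rank $r$, $$\frac{d\mathcal{G}_\Sigma}{d\mathcal{G}_I}(U)=\left(\frac{\det(X^*X)}{\det(X^*\Sigma^{-1}X)}\right)^{i_{\mathbb{F}}m/2},\qquad i_{\mathbb{F}}=\dim_{\mathbb{R}}\mathbb{F}.$$ A Grassmannian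 (maximum likelihood) estimate, abbreviated GE, of $P$ is a parameter $\Sigma\in\mathrm{Pos}(m)$ that maximizes $\int\log(d\mathcal{G}_\Sigma/d\mathcal{G}_I)\,dP$ over $\mathrm{Pos}(m)$; equivalently, it minimizes $\ell_P(\Sigma)=\int_{\mathrm{G}(m,r)}\ell_U(\Sigma)\,dP(U)$ over $\mathrm{Pos}(m)$, where $\ell_U(\Sigma)=\frac12\log\frac{\det(X^*\Sigma^{-1}X)}{\det(X^*X)}$ for $U=\langle X\rangle$. ''$P$ has a unique GE'' means that there exists exactly one GE of $P$. *)

(* Defs.v *)
From HB Require Import structures.
From mathcomp Require Import all_boot all_order all_algebra.
From mathcomp Require Import complex.
From mathcomp Require Import all_classical all_reals all_analysis.

Set Implicit Arguments.
Unset Strict Implicit.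
Unset Printing Implicit Defensive.
Import Order.TTheory GRing.Theory Num.Theory.
Import numFieldNormedType.Exports.
Local Open Scope classical_set_scope.
Local Open Scope ring_scope.

Variant scalars := Reals | Complexes.

Definition scalar_field (R : realType) (k : scalars) : numFieldType :=
  match k with Reals => R : numFieldType | Complexes => R[i] : numFieldType end.

Definition conj_scalar (R : realType) (k : scalars) :
    {rmorphism scalar_field R k -> scalar_field R k} :=
  match k return {rmorphism scalar_field R k -> scalar_field R k} with
  | Reals => idfun : {rmorphism R -> R}
  | Complexes => @conjc R : {rmorphism R[i] -> R[i]}
  end.

Definition re_scalar (R : realType) (k : scalars) : scalar_field R k -> R :=
  match k return scalar_field R k -> R with
  | Reals => id
  | Complexes => @complex.Re R
  end.
Arguments re_scalar {R k}.

Definition real_dim (k : scalars) : nat :=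
  match k with Reals => 1 | Complexes => 2 end.

Definition adjmx (R : realType) (k : scalars) (m n : nat)
    (A : 'M[scalar_field R k]_(m, n)) : 'M[scalar_field R k]_(n, m) :=
  map_mx (conj_scalar R k) A^T.

(* For Complexes, [0 < z] in R[i] means that z is real and positive. *)
Definition Pos (R : realType) (k : scalars) (m : nat) :
    set 'M[scalar_field R k]_m :=
  [set S | [/\ adjmx S = S,
    forall x : 'cV[scalar_field R k]_m, x != 0 -> 0 < (adjmx x *m S *m x) 0 0
    & \det S = 1]].

(* The proof of r <= m is a parameter because measurable types have to be
   inhabited. *)
Record grassmannian (R : realType) (k : scalars) (m r : nat) (rm : (r <= m)%N) :=
  Grassmannian {
    grass_vspace :> {vspace 'cV[scalar_field R k]_m};
    _ : \dim grass_vspace == r }.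
Arguments grassmannian : clear implicits.

HB.instance Definition _ R k m r rm :=
  [isSub for @grass_vspace R k m r rm].
HB.instance Definition _ R k m r rm :=
  [Choice of grassmannian R k m r rm by <:].

Section grassmannian_structures.
Variables (R : realType) (k : scalars) (m r : nat) (rm : (r <= m)%N).
Local Notation F := (scalar_field R k).
Local Notation G := (grassmannian R k m r rm).

Lemma grassmannian_inhabited : exists U : {vspace 'cV[F]_m}, \dim U == r.
Proof.
exists <<take r (vbasis (fullv : {vspace 'cV[F]_m}))>>%VS.
set b := vbasis (fullv : {vspace 'cV[F]_m}).
have fb : free b by exact: basis_free (vbasisP _).
have : free (take r b).
  by move: fb; rewrite -{1}(cat_take_drop r b) => /catl_free.
move=> /eqP ->; rewrite size_takel// size_tuple dimvf /dim /=.
by rewrite muln1.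
Qed.

HB.instance Definition _ := isPointed.Build G
  (Grassmannian rm (xchooseP grassmannian_inhabited)).

Definition mxrange (X : 'M[F]_(m, r)) : {vspace 'cV[F]_m} :=
  limg (linfun (mulmx X : 'cV[F]_r -> 'cV[F]_m)).

Definition full_rank : set 'M[F]_(m, r) := [set X | \dim (mxrange X) = r].

(* Quotient topology of the map X |-> range X on the matrices of rank r. *)
Definition grass_open : set_system G := fun A =>
  @open (subspace full_rank)
    [set X | exists2 U : G, A U & grass_vspace U = mxrange X].

Lemma grass_openT : grass_open setT.
Proof.
rewrite /grass_open -open_subspaceIT (_ : _ `&` _ = full_rank).
  exact: open_subspaceT.
apply/seteqP; split => [X []//|X /[dup] rX /eqP rX']; split => //.
by exists (Grassmannian rm rX').
Qed.

Lemma grass_openI : setI_closed grass_open.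
Proof.
move=> A B oA oB; have := openI oA oB; congr open.
apply/seteqP; split => [X [[U AU UX] [V BV VX]]|X [U [AU BU] UX]].
  exists U => //; split => //; suff -> : U = V by [].
  by apply: val_inj; rewrite /= UX VX.
by split; exists U.
Qed.

Lemma grass_open_bigU (I : Type) (f : I -> set G) :
  (forall i, grass_open (f i)) -> grass_open (\bigcup_i f i).
Proof.
move=> fo; have := bigcup_open (D := setT) (fun i _ => fo i); congr open.
apply/seteqP; split => [X [i _ [U fiU UX]]|X [U [i _ fiU] UX]].
  by exists U => //; exists i.
by exists i => //; exists U.
Qed.

HB.instance Definition _ := isOpenTopological.Build G
  grass_openT grass_openI grass_open_bigU.

Definition grass_borel := g_sigma_algebraType (@open G).

HB.instance Definition _ := Measurable.on grass_borel.

Definition basis_mx (U : G) : 'M[F]_(m, r) :=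
  \matrix_(i, j) (vbasis (grass_vspace U))`_j i 0.

(* The density at U of the Grassmannian distribution of parameter S with
   respect to the uniform distribution; the ratio of determinants does not
   depend on the matrix X with range U. *)
Definition grass_density (S : 'M[F]_m) (U : G) : R :=
  let X := basis_mx U in
  (re_scalar (\det (adjmx X *m X))
   / re_scalar (\det (adjmx X *m invmx S *m X)))
  `^ ((real_dim k * m)%:R / 2).

Definition log_likelihood (P : probability grass_borel R) (S : 'M[F]_m) :
    \bar R :=
  (\int[P]_U (ln (grass_density S U))%:E)%E.

Definition is_GE (P : probability grass_borel R) (S : 'M[F]_m) : Prop :=
  Pos S /\
  forall T : 'M[F]_m, Pos T -> (log_likelihood P T <= log_likelihood P S)%E.

End grassmannian_structures.

Arguments grass_borel : clear implicits.

(* Main.v *)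
(* We minimize the mean of [log (det (X* T X) / det (X* X))] over the positive
   definite [T] of determinant 1; its minimizers are the inverses of the GEs.

   Necessity: multiply a minimizer [T] by 1/2 along [V]. This lowers
   [log det (X* T X)] by at least [dim (U :&: V) * log 2], whereas restoring
   determinant 1 costs [r / m * dim V * log 2]. If the inequality fails for [V],
   the new matrix is a second minimizer.

   Uniqueness: if [A] and [B] are minimizers, then with [M = A + B] and the
   parallel sum [H = (A^-1 + B^-1)^-1] one has [det M * det H = 1] and
   [det (X* H X) * det (X* M X) <= det (X* A X) * det (X* B X)]. By minimality
   equality holds for almost all [U], which makes [U] invariant under [M^-1 B].
   Hence [r <= dim (U :&: E) + dim (U :&: W)] for the kernel [E] and the range
   [W] of [M^-1 B - a], [a] an eigenvalue, and the inequalities for [E] and [W]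
   add up to a contradiction.

   Existence: pivoting in the decomposition [T = A* exp(diag x) A] keeps [A] in a
   compact set. If [x] escapes to infinity in the direction [d], the growth rate
   of [log det (X* T X)] is bounded below by a combination of the dimensions of
   the intersections of [U] with the flag that sorting [d] defines, and the
   inequalities for this flag make the mean rate positive. *)

Require Import Defs.
From mathcomp Require Import all_boot all_order all_algebra fingroup perm.
From mathcomp Require Import complex.
From mathcomp Require Import all_classical all_reals all_analysis.
From mathcomp Require Import measurable_realfun ring lra.

Set Implicit Arguments.
Unset Strict Implicit.
Unset Printing Implicit Defensive.
Import Order.TTheory GRing.Theory Num.Theory.
Import numFieldNormedType.Exports.
Local Open Scope classical_set_scope.
Local Open Scope ring_scope.

Local Notation "A ^H" := (adjmx A) (at level 8, format "A ^H").

(** Both fields are handled at once, so a spectral decomposition is replaced by an LDL*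
    decomposition, which comes from Schur complements over either field. Its factor is not unitary;
    the bound 1 on the entries gives compactness, and [|\det A| = 1] survives limits and keeps them
    invertible.

    The ratio [r / m] comes from scaling: multiplying [T] by [a] adds [r * ln a] to the mean and
    [m * ln a] to the logarithm of the determinant.

    For uniqueness, geodesic convexity would call for a midpoint of [A] and [B] and thus for matrix
    square roots. The pair formed by the sum and the parallel sum is rational in [A] and [B] and has
    the same product of determinants, so it suffices to compare sums of two values of the mean.

    For existence, the log-ratio divided by the size of [x] is uniformly bounded, but only a lower
    bound of its limit is under control. Truncating it from above by that bound turns the bound into
    a limit, and dominated convergence applies. *)

Definition real_scalar (R : realType) (k : scalars) :
    {rmorphism R -> scalar_field R k} :=
  match k return {rmorphism R -> scalar_field R k} with
  | Reals => idfun : {rmorphism R -> R}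
  | Complexes => real_complex R : {rmorphism R -> R[i]}
  end.

(** * Real and complex scalars in one notation *)

Section scalars.
Variables (R : realType) (k : scalars).
Local Notation F := (scalar_field R k).
Local Notation conj := (conj_scalar R k).
Local Notation iota := (real_scalar R k).

Lemma conj_scalarK : involutive conj.
Proof. by case: k => // -[a b] /=; rewrite opprK. Qed.

Lemma conj_real_scalar a : conj (iota a) = iota a.
Proof. by case: k => //=; rewrite oppr0. Qed.

Lemma re_real_scalar a : re_scalar (iota a) = a.
Proof. by case: k. Qed.

Lemma real_scalar_re (x : F) : conj x = x -> iota (re_scalar x) = x.
Proof.
case: k x => //= -[a b] /= [] /eqP; rewrite eq_sym -addr_eq0 -mulr2n mulrn_eq0/=.
by move=> /eqP ->.
Qed.

Lemma ler_real_scalar a b : (iota a <= iota b) = (a <= b).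
Proof. by case: k => //=; rewrite lecR. Qed.

Lemma ltr_real_scalar a b : (iota a < iota b) = (a < b).
Proof. by case: k => //=; rewrite ltcR. Qed.

Lemma ge0_conj_scalar (x : F) : 0 <= x -> conj x = x.
Proof.
case: k x => //= -[a b] /=; rewrite lecE /= => /andP[/eqP -> _].
by rewrite oppr0.
Qed.

Lemma conj_scalarM (x : F) : conj x * x = `|x| ^+ 2.
Proof.
case: k x => [x|[a b]] /=; first by rewrite real_normK ?num_real// expr2.
rewrite normc_def /= -rmorphXn /= sqr_sqrtr ?addr_ge0 ?sqr_ge0//.
by apply/eqP; rewrite eq_complex /=; apply/andP; split; apply/eqP; ring.
Qed.

Lemma re_scalarD (x y : F) : re_scalar (x + y) = re_scalar x + re_scalar y.
Proof. by case: k x y => // -[? ?] [? ?]. Qed.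

Lemma re_scalarN (x : F) : re_scalar (- x) = - re_scalar x.
Proof. by case: k x => // -[? ?]. Qed.

Lemma re_scalarM a (x : F) : re_scalar (iota a * x) = a * re_scalar x.
Proof. by case: k x => // -[? ?] /=; rewrite mul0r subr0. Qed.

Lemma ltr_re_scalar (x y : F) : x < y -> re_scalar x < re_scalar y.
Proof. by case: k x y => // -[? ?] [? ?]; rewrite ltcE => /andP[]. Qed.

Lemma re_scalar_le_norm (x : F) : iota `|re_scalar x| <= `|x|.
Proof.
case: k x => // -[a b]; rewrite normc_def /= lecR.
by rewrite -sqrtr_sqr ler_wsqrtr// lerDl sqr_ge0.
Qed.

Lemma norm_conj_scalar (x : F) : `|conj x| = `|x|.
Proof. by case: k x => // -[a b]; rewrite !normc_def /= sqrrN. Qed.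

Lemma norm_real_scalar a : `|iota a| = iota `|a|.
Proof. by case: k => //=; rewrite normc_def /= expr0n addr0 sqrtr_sqr. Qed.

End scalars.

(** * Positive definite matrices *)

Section adjoint.
Variables (R : realType) (k : scalars).
Local Notation F := (scalar_field R k).
Local Notation conj := (conj_scalar R k).
Local Notation iota := (real_scalar R k).

Lemma adjmxK m n (A : 'M[F]_(m, n)) : A^H^H = A.
Proof. by apply/matrixP => i j; rewrite !mxE conj_scalarK. Qed.

Lemma adjmxM m n p (A : 'M[F]_(m, n)) (B : 'M[F]_(n, p)) :
  (A *m B)^H = B^H *m A^H.
Proof. by rewrite /adjmx trmx_mul map_mxM. Qed.

Lemma adjmxD m n (A B : 'M[F]_(m, n)) : (A + B)^H = A^H + B^H.
Proof. by rewrite /adjmx linearD map_mxD. Qed.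

Lemma adjmxN m n (A : 'M[F]_(m, n)) : (- A)^H = - A^H.
Proof. by rewrite /adjmx linearN map_mxN. Qed.

Lemma adjmxB m n (A B : 'M[F]_(m, n)) : (A - B)^H = A^H - B^H.
Proof. by rewrite adjmxD adjmxN. Qed.

Lemma adjmxZ m n a (A : 'M[F]_(m, n)) : (a *: A)^H = conj a *: A^H.
Proof. by apply/matrixP => i j; rewrite !mxE rmorphM. Qed.

Lemma adjmx1 n : (1%:M : 'M[F]_n)^H = 1%:M.
Proof. by rewrite /adjmx trmx1 map_mx1. Qed.

Lemma adjmx0 m n : (0 : 'M[F]_(m, n))^H = 0.
Proof. by rewrite /adjmx trmx0 map_mx0. Qed.

Lemma det_adjmx n (A : 'M[F]_n) : \det A^H = conj (\det A).
Proof. by rewrite /adjmx det_map_mx det_tr. Qed.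

Lemma adjmx_inv n (A : 'M[F]_n) : (invmx A)^H = invmx A^H.
Proof. by rewrite /adjmx trmx_inv map_invmx. Qed.

Lemma adjmx_block m1 m2 n1 n2 (A : 'M[F]_(m1, n1)) (B : 'M[F]_(m1, n2))
    (C : 'M[F]_(m2, n1)) (D : 'M[F]_(m2, n2)) :
  (block_mx A B C D)^H = block_mx A^H C^H B^H D^H.
Proof. by rewrite /adjmx tr_block_mx map_block_mx. Qed.

Lemma adjmx_col m1 m2 n (A : 'M[F]_(m1, n)) (B : 'M[F]_(m2, n)) :
  (col_mx A B)^H = row_mx A^H B^H.
Proof. by rewrite /adjmx tr_col_mx map_row_mx. Qed.

Lemma adjmx_real_diag n (d : 'rV[R]_n) :
  (diag_mx (map_mx iota d))^H = diag_mx (map_mx iota d).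
Proof.
by apply/matrixP => i j; rewrite !mxE eq_sym rmorphMn /= conj_real_scalar;
  case: eqP => [->|].
Qed.

Lemma adjmx_mul_self n (x : 'cV[F]_n) : (x^H *m x) 0 0 = \sum_i `|x i 0| ^+ 2.
Proof. by rewrite mxE; apply: eq_bigr => i _; rewrite !mxE conj_scalarM. Qed.

Lemma adjmx_mul_self_ge0 n (x : 'cV[F]_n) : 0 <= (x^H *m x) 0 0.
Proof. by rewrite adjmx_mul_self sumr_ge0// => i _; rewrite exprn_ge0. Qed.

Lemma adjmx_mul_self_eq0 n (x : 'cV[F]_n) : (x^H *m x) 0 0 = 0 -> x = 0.
Proof.
rewrite adjmx_mul_self => /eqP; rewrite psumr_eq0; last first.
  by move=> i _; rewrite exprn_ge0.
move=> /allP x0; apply/matrixP => i j; rewrite ord1 mxE.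
have /implyP/(_ isT) := x0 i (mem_index_enum _).
by rewrite expf_eq0 /= normr_eq0 => /eqP.
Qed.

Lemma rank_mulmx_inj m n p (X : 'M[F]_(m, n)) (c : 'M[F]_(n, p)) :
  \rank X = n -> X *m c = 0 -> c = 0.
Proof.
move=> rX Xc; have rf : row_free X^T by rewrite /row_free mxrank_tr rX.
apply: trmx_inj; apply: (row_free_inj rf).
by rewrite -trmx_mul Xc !trmx0 mul0mx.
Qed.

Definition psdmx n (M : 'M[F]_n) :=
  M^H = M /\ forall x : 'cV[F]_n, 0 <= (x^H *m M *m x) 0 0.

Definition pdmx n (M : 'M[F]_n) :=
  M^H = M /\ forall x : 'cV[F]_n, x != 0 -> 0 < (x^H *m M *m x) 0 0.

Lemma pd_psd n (M : 'M[F]_n) : pdmx M -> psdmx M.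
Proof.
move=> [aM pM]; split=> // x; have [->|x0] := eqVneq x 0.
  by rewrite mulmx0 mxE.
exact/ltW/pM.
Qed.

Lemma psd_conj m n (M : 'M[F]_m) (X : 'M[F]_(m, n)) :
  psdmx M -> psdmx (X^H *m M *m X).
Proof.
move=> [aM pM]; split; first by rewrite !adjmxM adjmxK aM mulmxA.
by move=> x; have := pM (X *m x); rewrite adjmxM !mulmxA.
Qed.

Lemma pd_conj m n (M : 'M[F]_m) (X : 'M[F]_(m, n)) :
  \rank X = n -> pdmx M -> pdmx (X^H *m M *m X).
Proof.
move=> rX [aM pM]; split; first by rewrite !adjmxM adjmxK aM mulmxA.
move=> x x0; have := pM (X *m x); rewrite adjmxM !mulmxA; apply.
by apply: contra_neq x0; exact: rank_mulmx_inj.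
Qed.

Lemma pd1 n : pdmx (1%:M : 'M[F]_n).
Proof.
split; first exact: adjmx1.
move=> x x0; rewrite mulmx1 lt_def adjmx_mul_self_ge0 andbT.
by apply: contra_neq x0; exact: adjmx_mul_self_eq0.
Qed.

Lemma pd_unit n (M : 'M[F]_n) : pdmx M -> M \in unitmx.
Proof.
move=> [aM pM]; rewrite unitmxE unitfE; apply/det0P => -[v v0 vM].
have /pM : v^H != 0.
  by apply: contra_neq v0 => v0; rewrite -(adjmxK v) v0 adjmx0.
by rewrite adjmxK vM mul0mx mxE ltxx.
Qed.

Lemma pd_inv n (M : 'M[F]_n) : pdmx M -> pdmx (invmx M).
Proof.
move=> pM; have uM := pd_unit pM; have [aM _] := pM.
have -> : invmx M = (invmx M)^H *m M *m invmx M.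
  by rewrite adjmx_inv aM mulVmx// mul1mx.
by apply: pd_conj => //; rewrite mxrank_unit// unitmx_inv.
Qed.

Lemma psdD n (M N : 'M[F]_n) : psdmx M -> psdmx N -> psdmx (M + N).
Proof.
move=> [aM pM] [aN pN]; split; first by rewrite adjmxD aM aN.
by move=> x; rewrite mulmxDr mulmxDl mxE addr_ge0.
Qed.

Lemma pdD n (M N : 'M[F]_n) : pdmx M -> psdmx N -> pdmx (M + N).
Proof.
move=> [aM pM] [aN pN]; split; first by rewrite adjmxD aM aN.
by move=> x x0; rewrite mulmxDr mulmxDl mxE ltr_wpDr// pM.
Qed.

Lemma psdZ n a (M : 'M[F]_n) : 0 <= a -> psdmx M -> psdmx (iota a *: M).
Proof.
move=> a0 [aM pM]; split; first by rewrite adjmxZ conj_real_scalar aM.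
move=> x; rewrite -scalemxAr -scalemxAl mxE mulr_ge0//.
by rewrite -(rmorph0 iota) ler_real_scalar.
Qed.

Lemma pdZ n a (M : 'M[F]_n) : 0 < a -> pdmx M -> pdmx (iota a *: M).
Proof.
move=> a0 [aM pM]; split; first by rewrite adjmxZ conj_real_scalar aM.
move=> x x0; rewrite -scalemxAr -scalemxAl mxE mulr_gt0// ?pM//.
by rewrite -(rmorph0 iota) ltr_real_scalar.
Qed.

(* Block LDL* decomposition with a 1 x 1 pivot; [S] is the Schur complement. *)
Lemma schur_decomp n (a : F) (b : 'M[F]_(n, 1)) (C : 'M[F]_n) :
  a != 0 -> conj a = a ->
  let L := block_mx 1%:M (a^-1 *: b^H) 0 1%:M : 'M[F]_(1 + n) in
  let S := C - a^-1 *: (b *m b^H) in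
  block_mx a%:M b^H b C = L^H *m block_mx a%:M 0 0 S *m L.
Proof.
move=> a0 ca L S; rewrite /L adjmx_block !adjmx1 adjmx0 adjmxZ adjmxK.
rewrite fmorphV ca !mulmx_block !mulmx0 !mul0mx !mul1mx !mulmx1 !addr0 !add0r.
have ab : a^-1 *: b *m a%:M = b.
  by rewrite mul_mx_scalar scalerA divff// scale1r.
rewrite ab; congr block_mx.
  by rewrite mul_scalar_mx scalerA divff// scale1r.
by rewrite -scalemxAr addrC subrK.
Qed.

Lemma pd_block n (a : F) (b : 'M[F]_(n, 1)) (C : 'M[F]_n) :
  pdmx (block_mx a%:M b^H b C : 'M[F]_(1 + n)) ->
  0 < a /\ pdmx (C - a^-1 *: (b *m b^H)).
Proof.
set M := block_mx _ _ _ _ => -[aM pM].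
have a0 : 0 < a.
  have /pM : col_mx (1%:M : 'M[F]_1) (0 : 'cV[F]_n) != 0.
    apply/eqP => /matrixP/(_ (lshift n 0) 0).
    by rewrite col_mxEu !mxE => /eqP; rewrite oner_eq0.
  rewrite adjmx_col adjmx1 adjmx0 mul_row_block mul_row_col.
  by rewrite !mul0mx !mul1mx !addr0 mulmx1 mulmx0 addr0 mxE.
have a1 := lt0r_neq0 a0; have ca := ge0_conj_scalar (ltW a0).
split => //; split.
  move: aM; rewrite adjmx_block => /eq_block_mx[_ _ _ aC].
  by rewrite adjmxB aC adjmxZ fmorphV ca adjmxM adjmxK.
move=> y y0.
(* The factor [L] of the Schur decomposition clears the first entry of this vector, so the form of
   [M] at it is the form of the Schur complement at [y]. *)
have /pM : col_mx (- (a^-1 *: b^H *m y)) y != 0.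
  apply: contra_neq y0 => /matrixP e; apply/matrixP => i j.
  by have := e (rshift 1 i) j; rewrite col_mxEd !mxE.
rewrite /M (schur_decomp _ _ a1 ca); set L := block_mx _ _ _ _.
rewrite -!mulmxA [L *m _]mul_block_col !mul0mx !mul1mx add0r addNr.
rewrite mulmxA -adjmxM [L *m _]mul_block_col !mul0mx !mul1mx add0r addNr.
rewrite mul_block_col adjmx_col mul_row_col !mul0mx adjmx0 mul0mx !add0r.
by rewrite mulmxA.
Qed.

End adjoint.

(** * Determinant inequalities *)

Section determinants.
Variables (R : realType) (k : scalars).
Local Notation F := (scalar_field R k).
Local Notation conj := (conj_scalar R k).
Local Notation iota := (real_scalar R k).

Lemma det_schur n (a : F) (b : 'M[F]_(n, 1)) (C : 'M[F]_n) :
  a != 0 -> conj a = a ->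
  \det (block_mx a%:M b^H b C : 'M[F]_(1 + n)) =
  a * \det (C - a^-1 *: (b *m b^H)).
Proof.
move=> a0 ca; rewrite schur_decomp// !det_mulmx adjmx_block adjmx0.
by rewrite det_lblock !det_ublock !adjmx1 !det1 det_scalar1 !mul1r !mulr1.
Qed.

Lemma block_mx_selfadjoint n (M : 'M[F]_(1 + n)) : M^H = M ->
  M = block_mx (M 0 0)%:M (dlsubmx M)^H (dlsubmx M) (drsubmx M).
Proof.
move=> aM; rewrite -[LHS]submxK; congr block_mx.
  by rewrite [LHS]mx11_scalar; congr _%:M; rewrite !mxE lshift0.
by rewrite -[in LHS]aM; apply/matrixP => i j; rewrite !mxE.
Qed.

(** Both the pivot and the Schur complement inherit the bound below by the identity, so induction on
    the size replaces an argument on eigenvalues. *)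
Lemma det_ge1 n (M : 'M[F]_n) : psdmx (M - 1%:M) ->
  1 <= \det M /\ (\det M = 1 -> M = 1%:M).
Proof.
elim: n M => [|n IH] M.
  by rewrite det_mx00 [M]flatmx0 [1%:M]flatmx0.
move=> pN1; have [aM pM] : pdmx M.
  by rewrite -(subrK 1%:M M) addrC; apply: pdD => //; exact: pd1.
set N := M - 1%:M in pN1; have [aN qN] := pN1.
have eM := block_mx_selfadjoint aM.
move: (M 0 0) (dlsubmx _) (drsubmx _) eM => a b C eM.
have [a_gt0 pS] : 0 < a /\ pdmx (C - a^-1 *: (b *m b^H)).
  by apply: pd_block; rewrite -eM.
have a0 := lt0r_neq0 a_gt0; have ca := ge0_conj_scalar (ltW a_gt0).
set S := C - _ in pS.
pose Q (x : 'cV[F]_(1 + n)) :=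
  (x^H *m block_mx a%:M b^H b C *m x) 0 0 - (x^H *m x) 0 0.
have Q0 x : 0 <= Q x.
  have := qN x; rewrite /N mulmxBr mulmxBl mulmx1 eM.
  by rewrite [X in 0 <= X -> _]mxE [X in 0 <= _ + X -> _]mxE.
have a1 : 1 <= a.
  have := Q0 (col_mx (1%:M : 'M[F]_1) (0 : 'cV[F]_n)).
  rewrite /Q adjmx_col adjmx1 adjmx0.
  rewrite mul_row_block !mul_row_col !mul0mx !mul1mx !mulmx0.
  by rewrite !addr0 mulmx1 !mxE subr_ge0.
(* Minimizing the form of [M] over the first entry leaves that of [S]. The squared norm of the
   minimizing entry [u] is what the identity matrix contributes on top of [y]. *)
have sumS y : let u := - (a^-1 *: b^H *m y) in
    (y^H *m (S - 1%:M) *m y) 0 0 = Q (col_mx u y) + (u^H *m u) 0 0.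
  move=> u; rewrite /Q schur_decomp//; set L := block_mx _ _ _ _.
  have Lx : L *m col_mx u y = col_mx 0 y.
    by rewrite mul_block_col !mul0mx !mul1mx add0r addNr.
  rewrite -!mulmxA Lx !mulmxA -adjmxM Lx.
  rewrite !adjmx_col mul_row_block !mul_row_col ?mulmx0 ?adjmx0 ?mul0mx.
  have entD (A B : 'M[F]_1) : (A + B) 0 0 = A 0 0 + B 0 0 by rewrite mxE.
  have entN (A : 'M[F]_1) : (- A) 0 0 = - A 0 0 by rewrite mxE.
  by rewrite ?add0r mulmxBr mulmxBl mulmx1 -/S !(entD, entN); ring.
have [|dS1 dSe] := IH S.
  split; first by rewrite adjmxB adjmx1 (proj1 pS).
  by move=> y; rewrite sumS addr_ge0// adjmx_mul_self_ge0.
rewrite eM det_schur//; split; first exact: mulr_ege1.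
move=> ad; have a_eq1 : a = 1.
  apply: le_anti; rewrite a1 andbT -ad -[leLHS]mulr1 ler_wpM2l//.
  exact: (le_trans ler01).
have S1 : S = 1%:M by apply: dSe; move: ad; rewrite {1}a_eq1 mul1r.
(* With [S = 1] the left side of [sumS] vanishes, hence both nonnegative terms on the right do; unit
   vectors [y] then read off the entries of [b]. *)
have b0 : b^H = 0.
  apply/matrixP => i j; rewrite ord1 [RHS]mxE.
  have := sumS (delta_mx j 0); rewrite /= S1 subrr mulmx0 mul0mx [LHS]mxE.
  set u := - _ => /esym/eqP.
  rewrite paddr_eq0// ?adjmx_mul_self_ge0// => /andP[_ /eqP].
  move=> /adjmx_mul_self_eq0/eqP; rewrite oppr_eq0 a_eq1 invr1 scale1r.
  rewrite -colE => /eqP/matrixP/(_ 0 0).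
  by rewrite !mxE.
have b0' : b = 0 by rewrite -(adjmxK b) b0 adjmx0.
move: S1; rewrite /S b0 b0' mulmx0 scaler0 subr0 => ->.
by rewrite a_eq1 -scalar_mx_block.
Qed.

Lemma pd_diag_gt0 n (M : 'M[F]_n) i : pdmx M -> 0 < M i i.
Proof.
move=> [_ pM]; have := pM (delta_mx i 0).
have -> : (delta_mx i 0 : 'cV[F]_n)^H = delta_mx 0 i.
  by apply/matrixP => a b; rewrite !mxE rmorph_nat andbC.
rewrite -rowE -colE !mxE; apply.
apply/eqP => /matrixP/(_ i 0); rewrite !mxE !eqxx => /eqP.
by rewrite oner_eq0.
Qed.

(* LDL* decomposition with diagonal pivoting: choosing the largest diagonal entry
   as pivot keeps the entries of the factor [A] in the unit disc. *)
Lemma pivoted_ldl n (M : 'M[F]_n) : pdmx M ->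
  exists (A : 'M[F]_n) (d : 'rV[R]_n),
  [/\ M = A^H *m diag_mx (map_mx iota d) *m A, forall i, 0 < d 0 i,
      `|\det A| = 1 & forall i j, `|A i j| <= 1].
Proof.
elim: n M => [|n IH] M pM.
  exists 1%:M, 0; split; try by case.
  - by rewrite [LHS]flatmx0 [RHS]flatmx0.
  - by rewrite det1 normr1.
(* Conjugating by a transposition brings the largest diagonal entry to the front. The permutation is
   absorbed into [A], which changes neither the moduli of its entries nor that of its
   determinant. *)
wlog M00 : M pM / forall i, M i i <= M 0 0.
  move=> W; pose i0 := [arg max_(i > ord0) re_scalar (M i i)]%O.
  have Mi0 i : M i i <= M i0 i0.
    rewrite /i0; case: arg_maxP => // i1 _ /(_ i isT) /=.
    rewrite -(ler_real_scalar k) !real_scalar_re//; apply: ge0_conj_scalar;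
      exact/ltW/pd_diag_gt0.
  pose s := tperm 0 i0.
  have Ps : (perm_mx s : 'M[F]_n.+1)^H = perm_mx s^-1.
    by rewrite /adjmx tr_perm_mx map_perm_mx.
  pose M' := row_perm s (col_perm s M).
  have eM' : M' = (perm_mx s^-1)^H *m M *m perm_mx s^-1.
    by rewrite /M' row_permE col_permE /adjmx tr_perm_mx map_perm_mx invgK mulmxA.
  have [||A [d [eA d0 dA A1]]] := W M'.
  - rewrite eM'; apply: pd_conj => //.
    by rewrite mxrank_unit// unitmx_perm.
  - by move=> i; rewrite !mxE tpermL.
  exists (A *m perm_mx s), d; split => //.
  - have -> : M = (perm_mx s)^H *m M' *m perm_mx s.
      rewrite eM' Ps /adjmx tr_perm_mx map_perm_mx invgK !mulmxA -perm_mxM mulVg.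
      by rewrite perm_mx1 mul1mx -mulmxA -perm_mxM mulVg perm_mx1 mulmx1.
    by rewrite eA adjmxM !mulmxA.
  - by rewrite det_mulmx normrM dA mul1r det_perm normrX normrN normr1 expr1n.
  - by move=> i j; rewrite -[s]invgK -col_permE mxE.
have [aM _] := pM; have eM := block_mx_selfadjoint aM.
move: (pM); rewrite eM => /pd_block.
set a := M 0 0 in eM *; set b := dlsubmx _ in eM *; set C := drsubmx _ in eM *.
move=> [a_gt0 pS]; have a0 := lt0r_neq0 a_gt0.
have ca := ge0_conj_scalar (ltW a_gt0).
have [A [d [eA d0 dA A1]]] := IH _ pS.
(* The Schur complement has positive diagonal, so [|b i 0| ^+ 2 / a] is below a diagonal entry of
   [M], hence below [a]. This puts the new row of [L] in the unit disc. *)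
have b_le i : `|b i 0| <= a.
  have := pd_diag_gt0 i pS; rewrite !mxE big_ord1 !mxE subr_gt0 => bC.
  have Ca : M (rshift 1 i) (rshift 1 i) <= a by exact: M00.
  have : a^-1 * `|b i 0| ^+ 2 <= a.
    apply: le_trans Ca; apply: ltW.
    by rewrite -conj_scalarM [conj _ * _]mulrC; move: bC; rewrite !mxE.
  rewrite ler_pdivrMl// -expr2 ler_pXn2r ?nnegrE ?normr_ge0 ?(ltW a_gt0)//.
  by rewrite !mxE.
pose L : 'M[F]_(1 + n) := block_mx 1%:M (a^-1 *: b^H) 0 A.
pose D : 'rV[R]_(1 + n) := row_mx (re_scalar a)%:M d.
have eL : block_mx a%:M b^H b C = L^H *m diag_mx (map_mx iota D) *m L.
  rewrite /L /D map_row_mx diag_mx_row adjmx_block !adjmx0 adjmx1 adjmxZ adjmxK.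
  have -> : diag_mx (map_mx iota (re_scalar a)%:M) = a%:M :> 'M[F]_1.
    by rewrite [LHS]mx11_scalar !mxE mulr1n real_scalar_re.
  rewrite fmorphV ca !mulmx_block !mulmx0 !mul0mx !mul1mx !mulmx1 !addr0 !add0r.
  rewrite mul_scalar_mx scalerA divff// scale1r.
  rewrite mul_mx_scalar scalerA divff// scale1r ?mul0mx ?addr0.
  by rewrite -eA -scalemxAr addrC subrK.
exists L, D; split; first exact: eL.
- move=> i; rewrite mxE; case: splitP => j _; last exact: d0.
  rewrite !ord1 mxE mulr1n -(ltr_real_scalar k) rmorph0 real_scalar_re//.
- have -> : \det L = \det A by rewrite /L det_ublock det1 mul1r.
  exact: dA.
- move=> i j; rewrite mxE; case: splitP => i' _; rewrite mxE; case: splitP => j' _.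
  + by rewrite !ord1 mxE normr1.
  + rewrite !mxE !ord1 normrM normfV (gtr0_norm a_gt0) norm_conj_scalar.
    by rewrite ler_pdivrMl// mulr1; have := b_le j'; rewrite !mxE.
  + by rewrite mxE normr0.
  + exact: A1.
Qed.

Lemma det_ldl n (A : 'M[F]_n) (d : 'rV[R]_n) : `|\det A| = 1 ->
  \det (A^H *m diag_mx (map_mx iota d) *m A) = iota (\prod_i d 0 i).
Proof.
move=> dA; rewrite !det_mulmx det_adjmx mulrAC conj_scalarM dA expr1n mul1r.
by rewrite det_diag rmorph_prod; apply: eq_bigr => i _; rewrite mxE.
Qed.

Lemma pd_det_gt0 n (M : 'M[F]_n) : pdmx M -> 0 < \det M.
Proof.
move=> /pivoted_ldl [A [d [-> d0 dA _]]]; rewrite det_ldl//.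
by rewrite -(rmorph0 iota) ltr_real_scalar prodr_gt0.
Qed.

(** Taking roots of the diagonal part of the LDL* decomposition gives a substitute for the matrix
    square root. *)
Lemma pd_factor n (M : 'M[F]_n) : pdmx M ->
  exists2 B : 'M[F]_n, B \in unitmx & M = B^H *m B.
Proof.
move=> pM; have [A [d [eM d0 dA _]]] := pivoted_ldl pM.
exists (diag_mx (map_mx (iota \o Num.sqrt) d) *m A).
  rewrite unitmx_mul !unitmxE !unitfE -[\det A == 0]normr_eq0 dA oner_eq0 andbT.
  rewrite det_diag prodf_seq_neq0; apply/allP => i _ /=.
  by rewrite !mxE fmorph_eq0 sqrtr_eq0 -ltNge.
rewrite adjmxM map_mx_comp adjmx_real_diag mulmxA -[_ *m diag_mx _ *m diag_mx _]mulmxA.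
rewrite mulmx_diag eM; congr (_ *m _ *m _); congr diag_mx.
apply/matrixP => i j; rewrite !mxE ord1 -rmorphM /= -expr2 sqr_sqrtr//.
exact: ltW.
Qed.

(** A congruence that takes [N] to the identity reduces this to [det_ge1]. The equality case is what
    uniqueness rests on. *)
Lemma det_monotone n (M N : 'M[F]_n) : pdmx N -> psdmx (M - N) ->
  \det N <= \det M /\ (\det N = \det M -> N = M).
Proof.
move=> pN pMN; have [B uB eN] := pd_factor pN.
pose M' := (invmx B)^H *m M *m invmx B.
have eM : M = B^H *m M' *m B.
  rewrite /M' !mulmxA -adjmxM mulVmx// adjmx1 mul1mx.
  by rewrite -mulmxA mulVmx// mulmx1.
have [|d1 d1e] := @det_ge1 _ M'.
  have -> : M' - 1%:M = (invmx B)^H *m (M - N) *m invmx B.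
    rewrite mulmxBr mulmxBl; congr (_ - _); rewrite eN !mulmxA -adjmxM mulmxV//.
    by rewrite adjmx1 mul1mx mulmxV.
  exact: psd_conj.
have dN := pd_det_gt0 pN.
have -> : \det M = \det N * \det M'.
  by rewrite eM eN !det_mulmx mulrAC mulrC mulrA.
split; first by rewrite ler_peMr// ltW.
rewrite -[LHS]mulr1 => /(mulfI (lt0r_neq0 dN))/esym/d1e M'1.
by rewrite eM M'1 mulmx1.
Qed.

(** Both sides are the determinant of one block matrix, factored with either diagonal block as
    pivot. *)
Lemma sylvester_det p q (A : 'M[F]_(p, q)) (B : 'M[F]_(q, p)) :
  \det (1%:M + A *m B) = \det (1%:M + B *m A).
Proof.
have E1 : block_mx 1%:M (- A) B 1%:M =
    block_mx 1%:M 0 B 1%:M *m block_mx 1%:M (- A) 0 (1%:M + B *m A).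
  rewrite mulmx_block !mulmx0 !mul0mx !mul1mx !mulmx1 !addr0.
  by rewrite mulmxN addrC addrK.
have E2 : block_mx 1%:M (- A) B 1%:M =
    block_mx 1%:M (- A) 0 1%:M *m block_mx (1%:M + A *m B) 0 B 1%:M.
  by rewrite mulmx_block !mulmx0 !mul0mx !mul1mx !mulmx1 !add0r mulNmx addrK.
have := congr1 determinant E1; rewrite {1}E2 !det_mulmx.
by rewrite !det_ublock !det_lblock !det1 !mul1r mulr1.
Qed.

(* [Y (Y* M Y)^-1 Y* M] is the [M]-orthogonal projection onto the range of
   [Y]. *)
Lemma projection_psd n p (M : 'M[F]_n) (Y : 'M[F]_(n, p)) :
  pdmx M -> \rank Y = p ->
  let E := invmx M - Y *m invmx (Y^H *m M *m Y) *m Y^H in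
  E^H = E /\ E = E^H *m M *m E.
Proof.
move=> pM rY E; have pN := pd_conj rY pM; have [aM _] := pM; have [aN _] := pN.
have aE : E^H = E.
  by rewrite /E adjmxB !adjmxM adjmxK !adjmx_inv aM aN mulmxA.
split=> //; rewrite aE {2}/E mulmxBl mulVmx ?pd_unit// mulmxBl mul1mx.
suff -> : Y *m invmx (Y^H *m M *m Y) *m Y^H *m M *m E = 0 by rewrite subr0.
set N := Y^H *m M *m Y in pN E aE *.
rewrite /E mulmxBr mulmxK ?pd_unit// !mulmxA -(mulmxA _ Y^H M) -(mulmxA _ _ Y).
by rewrite -/N mulmxKV ?pd_unit// subrr.
Qed.

End determinants.

(** * Parallel sums and shrinking along a subspace *)

Section matrix_inequalities.
Variables (R : realType) (k : scalars).
Local Notation F := (scalar_field R k).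
Local Notation conj := (conj_scalar R k).
Local Notation iota := (real_scalar R k).

Lemma psd_sub_conj m n (M N : 'M[F]_m) (X : 'M[F]_(m, n)) :
  psdmx (M - N) -> psdmx (X^H *m M *m X - X^H *m N *m X).
Proof. by rewrite -mulmxBl -mulmxBr; exact: psd_conj. Qed.

Lemma pd_form_eq0 m n (M : 'M[F]_m) (X : 'M[F]_(m, n)) :
  pdmx M -> X^H *m M *m X = 0 -> X = 0.
Proof.
move=> [_ pM] X0; apply/matrixP => i j; have : col j X = 0.
  apply/eqP/negPn/negP => /pM.
  have -> : (col j X)^H = row j X^H by apply/matrixP => a b; rewrite !mxE.
  by rewrite -!row_mul colE mulmxA X0 mul0mx row0 mxE ltxx.
by move/matrixP/(_ i 0); rewrite !mxE.
Qed.

Section parallel_sum.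
Variables (n : nat) (A B : 'M[F]_n).
Hypotheses (pA : pdmx A) (pB : pdmx B).
Let M := A + B.

(** Written as a Schur complement, [(A^-1 + B^-1)^-1] can be compared with the same expression
    formed from compressions of [A] and [B]. *)
Definition parallel_sum := B - B *m invmx (A + B) *m B.

Let pM : pdmx M. Proof. exact/pdD/pd_psd. Qed.

Lemma parallel_sumE : parallel_sum = B *m invmx M *m A.
Proof.
rewrite /parallel_sum -/M; have e : A = M - B by rewrite /M addrK.
by rewrite [in RHS]e mulmxBr mulmxKV ?pd_unit.
Qed.

Lemma parallel_sumEC : parallel_sum = A *m invmx M *m B.
Proof.
rewrite /parallel_sum -/M; have e : A = M - B by rewrite /M addrK.
by rewrite [in RHS]e !mulmxBl mulmxV ?pd_unit// mul1mx.
Qed.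

Lemma det_parallel_sum : \det parallel_sum * \det M = \det A * \det B.
Proof.
rewrite parallel_sumE !det_mulmx det_inv.
by rewrite mulrAC divfK 1?mulrC// lt0r_neq0// pd_det_gt0.
Qed.

Lemma pd_parallel_sum : pdmx parallel_sum.
Proof.
have pV : pdmx (invmx A + invmx B) by apply/pdD/pd_psd; exact: pd_inv.
suff -> : parallel_sum = invmx (invmx A + invmx B) by exact: pd_inv.
suff VH : (invmx A + invmx B) *m parallel_sum = 1%:M.
  by rewrite -[LHS]mul1mx -(mulVmx (pd_unit pV)) -mulmxA VH mulmx1.
rewrite mulmxDl {1}parallel_sumEC parallel_sumE -!mulmxA !mulKmx ?pd_unit//.
by rewrite -mulmxDr addrC mulVmx ?pd_unit.
Qed.

(** The parallel sum [K] of the compressions [P] and [Q] dominates the compression of the parallel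
    sum: their difference is the form of [E] at [B *m X], with [E] as in [projection_psd]. Equality
    of determinants makes [E *m (B *m X)] vanish, which says that [invmx M *m B] maps the range of
    [X] into itself. *)
Lemma det_parallel_sum_le r (X : 'M[F]_(n, r)) : \rank X = r ->
  let l := \det (X^H *m parallel_sum *m X) * \det (X^H *m M *m X) in
  let u := \det (X^H *m A *m X) * \det (X^H *m B *m X) in
  l <= u /\ (l = u -> exists W : 'M[F]_r, invmx M *m B *m X = X *m W).
Proof.
move=> rX l u; pose P := X^H *m A *m X; pose Q := X^H *m B *m X.
pose N := X^H *m M *m X; have pN : pdmx N by exact: pd_conj.
have PQ : P = N - Q by rewrite /P /N /Q -mulmxBl -mulmxBr addrK.
pose K := Q - Q *m invmx N *m Q.
have detK : \det K * \det N = u.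
  have -> : K = Q *m invmx N *m P.
    by rewrite PQ mulmxBr mulmxKV ?pd_unit.
  rewrite !det_mulmx det_inv /u -/P -/Q.
  by rewrite mulrAC divfK 1?mulrC// lt0r_neq0// pd_det_gt0.
have [aE EE] := projection_psd pM rX; set E := _ - _ in aE EE.
have [aB _] := pB.
have KE : K - X^H *m parallel_sum *m X = (E *m (B *m X))^H *m M *m (E *m (B *m X)).
  have -> : (E *m (B *m X))^H *m M *m (E *m (B *m X)) =
      (B *m X)^H *m E *m (B *m X) by rewrite [in RHS]EE !adjmxM !mulmxA.
  rewrite /K /parallel_sum -/M -/N adjmxM aB /E mulmxBr mulmxBl.
  rewrite mulmxBr mulmxBl -/Q opprB addrC addrA subrK.
  by rewrite !mulmxA.
have pS := pd_conj rX pd_parallel_sum.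
have [|le_l eq_l] := det_monotone pS (_ : psdmx (K - _)).
  by rewrite KE; apply/psd_conj/pd_psd.
split; first by rewrite /l -detK ler_pM2r// pd_det_gt0.
rewrite /l -detK => /(mulIf (lt0r_neq0 (pd_det_gt0 pN)))/eq_l SK.
move: KE; rewrite SK subrr => /esym/(pd_form_eq0 pM)/eqP.
rewrite /E mulmxBl subr_eq0 => /eqP e.
by exists (invmx N *m X^H *m (B *m X)); rewrite -mulmxA e !mulmxA.
Qed.

End parallel_sum.

(* [shrink T Q c] is [T] multiplied by [c] along the range of [Q] and unchanged on
   its [T]-orthogonal complement. *)
Definition shrink n p (T : 'M[F]_n) (Q : 'M[F]_(n, p)) (c : R) : 'M[F]_n :=
  T - iota (1 - c) *: (T *m Q *m invmx (Q^H *m T *m Q) *m Q^H *m T).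

(** The matrix is [c] times [T] plus [1 - c] times a semidefinite congruence of the defect [E] of
    the projection onto the range of [Q]. *)
Lemma pd_shrink n p (T : 'M[F]_n) (Q : 'M[F]_(n, p)) c :
  pdmx T -> \rank Q = p -> 0 < c -> c <= 1 -> pdmx (shrink T Q c).
Proof.
move=> pT rQ c0 c1; have [aE EE] := projection_psd pT rQ; set E := _ - _ in aE EE.
have [aT _] := pT.
have -> : shrink T Q c = iota c *: T + iota (1 - c) *: (T^H *m E *m T).
  rewrite /shrink /E aT mulmxBr mulmxBl mulmxV ?pd_unit// mul1mx scalerBr addrA.
  by rewrite -scalerDl -rmorphD [c + _]addrC subrK rmorph1 scale1r !mulmxA.
apply: pdD; first exact: pdZ.
apply: psdZ; first by rewrite subr_ge0.
by apply: psd_conj; rewrite EE; apply/psd_conj/pd_psd.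
Qed.

(** Sylvester's identity moves the correction into a [p] by [p] determinant, where it becomes the
    scalar matrix [c]. *)
Lemma det_shrink n p (T : 'M[F]_n) (Q : 'M[F]_(n, p)) c :
  pdmx T -> \rank Q = p -> \det (shrink T Q c) = iota (c ^+ p) * \det T.
Proof.
move=> pT rQ; have pN := pd_conj rQ pT; set N := _ *m Q in pN.
have -> : shrink T Q c =
    T *m (1%:M + (- iota (1 - c) *: (Q *m invmx N)) *m (Q^H *m T)).
  rewrite /shrink -/N mulmxDr mulmx1 -scalemxAl -scalemxAr scaleNr.
  by rewrite !mulmxA.
rewrite det_mulmx sylvester_det -scalemxAr mulmxA -/N mulmxV ?pd_unit//.
rewrite -[X in X + _]scale1r -scalerDl rmorphB rmorph1 opprB addrC subrK.
by rewrite detZ det1 mulr1 mulrC rmorphXn.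
Qed.

(** Shrinking along the range of [Q] lowers the form at least as much as shrinking along its
    subspace, the range of [Q *m b]. Since the latter lies in the range of [X], compression by [X]
    turns the second operation into shrinking [X^H *m T *m X] along [a], whose determinant is
    known. *)
Lemma det_shrink_le n r p d (T : 'M[F]_n) (X : 'M[F]_(n, r)) (Q : 'M[F]_(n, p))
    (a : 'M[F]_(r, d)) (b : 'M[F]_(p, d)) c :
  pdmx T -> \rank X = r -> \rank Q = p -> 0 < c -> c <= 1 ->
  X *m a = Q *m b -> \rank a = d -> \rank b = d ->
  \det (X^H *m shrink T Q c *m X) <= iota (c ^+ d) * \det (X^H *m T *m X).
Proof.
move=> pT rX rQ c0 c1 XQ ra rb; have pN := pd_conj rX pT.
rewrite -(det_shrink c pN ra); apply: (det_monotone _ _).1.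
  by apply: pd_conj => //; exact: pd_shrink.
have -> : shrink (X^H *m T *m X) a c = X^H *m shrink T (Q *m b) c *m X.
  rewrite /shrink -XQ !adjmxM mulmxBr mulmxBl -scalemxAr -scalemxAl.
  by rewrite !mulmxA.
apply: psd_sub_conj.
rewrite /shrink opprB addrC addrA subrK -scalerBr.
apply: psdZ; first by rewrite subr_ge0.
have [aT _] := pT; have pQ := pd_conj rQ pT.
have [aE EE] := projection_psd pQ rb; set E := _ - _ in aE EE.
have -> : T *m Q *m invmx (Q^H *m T *m Q) *m Q^H *m T -
  T *m (Q *m b) *m invmx ((Q *m b)^H *m T *m (Q *m b)) *m (Q *m b)^H *m T =
  (Q^H *m T)^H *m E *m (Q^H *m T).
  by rewrite !adjmxM !adjmxK aT /E mulmxBr mulmxBl !mulmxA.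
by apply: psd_conj; rewrite EE; apply/psd_conj/pd_psd.
Qed.

End matrix_inequalities.

(** * Uniform bounds for pivoted factors, and a lower bound by one minor *)

Section bounds.
Variables (R : realType) (k : scalars).
Local Notation F := (scalar_field R k).
Local Notation iota := (real_scalar R k).

Lemma adjmx_scalar_real n a : (iota a *: 1%:M : 'M[F]_n)^H = iota a *: 1%:M.
Proof. by rewrite adjmxZ adjmx1 conj_real_scalar. Qed.

Lemma form_scalar n a (x : 'cV[F]_n) :
  (x^H *m (a *: 1%:M) *m x) 0 0 = a * (x^H *m x) 0 0.
Proof. by rewrite -scalemxAr -scalemxAl mulmx1 mxE. Qed.

Lemma psd_gram_bound m n (B : 'M[F]_(m, n)) (b : R) :
  (forall i j, `|B i j| <= iota b) ->
  psdmx (iota ((m * n.*2)%:R * b ^+ 2) *: 1%:M - B^H *m B).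
Proof.
move=> Bb; split; first by rewrite adjmxB adjmxM adjmxK adjmx_scalar_real.
move=> x; rewrite mulmxBr mulmxBl [X in _ <= X]mxE form_scalar.
rewrite [X in _ + X]mxE -!mulmxA (mulmxA x^H) -adjmxM subr_ge0.
rewrite !adjmx_mul_self.
suff bnd i : `|(B *m x) i 0| ^+ 2 <=
    n.*2%:R * (iota (b ^+ 2) * \sum_j `|x j 0| ^+ 2).
  apply: le_trans (ler_sum _ (fun i _ => bnd i)) _.
  have -> : iota ((m * n.*2)%:R * b ^+ 2) = m%:R * n.*2%:R * iota (b ^+ 2).
    by rewrite rmorphM /= rmorph_nat natrM.
  by rewrite sumr_const card_ord -[X in X <= _]mulr_natl !mulrA.
rewrite mxE; have : `|\sum_j B i j * x j 0| <= iota b * \sum_j `|x j 0|.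
  apply: le_trans (ler_norm_sum _ _ _) _; rewrite mulr_sumr ler_sum// => j _.
  by rewrite normrM ler_wpM2r.
move=> h; apply: (@le_trans _ _ ((iota b * \sum_j `|x j 0|) ^+ 2)).
  by rewrite ler_pXn2r// nnegrE// (le_trans _ h).
rewrite mulrCA exprMn rmorphXn ler_wpM2l//.
  by rewrite -rmorphXn -(rmorph0 iota) ler_real_scalar sqr_ge0.
rewrite expr2 mulr_suml [X in _ <= X]mulr_sumr.
(* The factor [n.*2] comes from the crude estimate of a product by the sum of two squares, summed
   over all pairs of indices. *)
have -> : \sum_i0 n.*2%:R * `|x i0 0| ^+ 2 =
    \sum_i0 \sum_j (`|x i0 0| ^+ 2 + `|x j 0| ^+ 2).
  under [RHS]eq_bigr do rewrite big_split /= sumr_const card_ord.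
  rewrite big_split /= sumr_const card_ord -sumrMnl -big_split /=.
  by apply: eq_bigr => j _; rewrite -addnn mulr_natl mulrnDr.
apply: ler_sum => j _; rewrite mulr_sumr; apply: ler_sum => l _.
have a0 := normr_ge0 (x j 0); have b0 := normr_ge0 (x l 0).
have /orP[ab|ba] : (`|x j 0| <= `|x l 0|) || (`|x l 0| <= `|x j 0|).
- exact: real_leVge.
- by rewrite (le_trans (ler_wpM2r b0 ab))// -expr2 lerDr exprn_ge0.
- by rewrite (le_trans (ler_wpM2l a0 ba))// -expr2 lerDl exprn_ge0.
Qed.

Lemma norm_det_le n (B : 'M[F]_n) :
  (forall i j, `|B i j| <= 1) -> `|\det B| <= n`!%:R.
Proof.
move=> B1; rewrite -(card_Sn n) -sum1_card natr_sum.
apply: le_trans (ler_norm_sum _ _ _) _.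
rewrite [X in _ <= X](eq_bigl xpredT); last by move=> s; rewrite inE.
apply: ler_sum => s _.
rewrite normrM normrX normrN normr1 expr1n mul1r normr_prod.
by apply: prodr_ile1 => i _; rewrite normr_ge0 B1.
Qed.

Lemma norm_invmx_le n (A : 'M[F]_n) i j : `|\det A| = 1 ->
  (forall i j, `|A i j| <= 1) -> `|invmx A i j| <= (n.-1)`!%:R.
Proof.
move=> dA A1; have uA : A \in unitmx.
  by rewrite unitmxE unitfE -normr_eq0 dA oner_eq0.
rewrite /invmx uA mxE normrM normfV dA invr1 mul1r mxE /cofactor.
rewrite normrM normrX normrN normr1 expr1n mul1r.
by apply: norm_det_le => a b; rewrite !mxE.
Qed.

(** The lower bound is the upper bound for [invmx A], conjugated back by [A]; up to a unit the
    entries of [invmx A] are cofactors, hence bounded by a factorial. The summand 1 in both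
    constants keeps them positive when [n = 0]. *)
Lemma gram_bounds n : exists2 c : R * R, 0 < c.1 /\ 0 < c.2 &
  forall A : 'M[F]_n, `|\det A| = 1 -> (forall i j, `|A i j| <= 1) ->
  psdmx (A^H *m A - iota c.1 *: 1%:M) /\ psdmx (iota c.2 *: 1%:M - A^H *m A).
Proof.
pose e : R := (n * n.*2)%:R * ((n.-1)`!%:R) ^+ 2.
exists ((1 + e)^-1, 1 + (n * n.*2)%:R).
  by split; rewrite /= ?invr_gt0 ltr_pwDl// ?mulr_ge0// ?ler0n// exprn_ge0// ler0n.
have e0 : 0 < 1 + e.
  by rewrite ltr_pwDl// mulr_ge0// ?ler0n// exprn_ge0// ler0n.
move=> A dA A1 /=; have uA : A \in unitmx.
  by rewrite unitmxE unitfE -normr_eq0 dA oner_eq0.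
split; last first.
  have [|aE pE] := psd_gram_bound (B := A) (b := 1).
    by move=> i j; rewrite rmorph1.
  rewrite expr1n mulr1 in aE pE.
  rewrite rmorphD scalerDl rmorph1 scale1r -addrA; apply: psdD => //.
  exact/pd_psd/pd1.
have pE : psdmx (iota e *: 1%:M - (invmx A)^H *m invmx A).
  by apply: psd_gram_bound => i j; rewrite rmorph_nat norm_invmx_le.
have p1 : psdmx (iota (1 + e) *: 1%:M - (invmx A)^H *m invmx A).
  rewrite rmorphD scalerDl rmorph1 scale1r -addrA; apply: psdD => //.
  exact/pd_psd/pd1.
have := psdZ (ltW _ : 0 <= (1 + e)^-1) (psd_conj A p1).
rewrite invr_gt0 => /(_ e0); congr psdmx.
rewrite mulmxBr mulmxBl !mulmxA -adjmxM mulVmx// adjmx1 mul1mx mulVmx//.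
rewrite scalerBr -scalemxAr -scalemxAl mulmx1 scalerA -rmorphM mulVf ?lt0r_neq0//.
by rewrite rmorph1 scale1r.
Qed.

Lemma psd_diag n (d : 'rV[R]_n) : (forall i, 0 <= d 0 i) ->
  psdmx (diag_mx (map_mx iota d)).
Proof.
move=> d0; split; first exact: adjmx_real_diag.
move=> x; rewrite mxE sumr_ge0// => i _; rewrite mul_mx_diag !mxE.
rewrite mulrAC conj_scalarM mulr_ge0 ?exprn_ge0//.
by rewrite -(rmorph0 iota) ler_real_scalar.
Qed.

Lemma pd_diag n (d : 'rV[R]_n) : (forall i, 0 < d 0 i) ->
  pdmx (diag_mx (map_mx iota d)).
Proof.
move=> d0; split; first exact: adjmx_real_diag.
move=> x x0; rewrite lt_def (psd_diag _).2 ?andbT; last by move=> i; exact: ltW.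
apply: contra_neq x0; rewrite mxE => /eqP; rewrite psumr_eq0; last first.
  move=> i _; rewrite mul_mx_diag !mxE mulrAC conj_scalarM mulr_ge0//.
  by rewrite -(rmorph0 iota) ler_real_scalar ltW.
move=> /allP x0; apply/matrixP => i j; rewrite ord1 [RHS]mxE.
have /implyP/(_ isT) := x0 i (mem_index_enum _).
rewrite mul_mx_diag !mxE mulrAC conj_scalarM mulf_eq0 fmorph_eq0.
by rewrite [d _ _ == _]gt_eqF// orbF expf_eq0 /= normr_eq0 => /eqP.
Qed.

Lemma ldl_bounds n (A : 'M[F]_n) (d : 'rV[R]_n) a b :
  (forall i, a <= d 0 i) -> (forall i, d 0 i <= b) ->
  psdmx (A^H *m diag_mx (map_mx iota d) *m A - iota a *: (A^H *m A)) /\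
  psdmx (iota b *: (A^H *m A) - A^H *m diag_mx (map_mx iota d) *m A).
Proof.
move=> ad db.
have E c : iota c *: (A^H *m A) = A^H *m diag_mx (map_mx iota (const_mx c)) *m A.
  by rewrite map_const_mx diag_const_mx mul_mx_scalar scalemxAl.
split; rewrite E -mulmxBl -mulmxBr -linearB /= -map_mxB; apply/psd_conj/psd_diag.
  by move=> i; rewrite !mxE subr_ge0.
by move=> i; rewrite !mxE subr_ge0.
Qed.

Lemma gram_det_bounds n r (T : 'M[F]_n) (X : 'M[F]_(n, r)) a b :
  \rank X = r -> 0 < a -> psdmx (T - iota a *: 1%:M) ->
  psdmx (iota b *: 1%:M - T) ->
  iota (a ^+ r) * \det (X^H *m X) <= \det (X^H *m T *m X) <=
  iota (b ^+ r) * \det (X^H *m X).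
Proof.
move=> rX a0 Ta Tb.
have E c : iota (c ^+ r) * \det (X^H *m X) = \det (X^H *m (iota c *: 1%:M) *m X).
  by rewrite -scalemxAr mulmx1 -scalemxAl detZ rmorphXn.
have pa : pdmx (X^H *m (iota a *: 1%:M) *m X).
  by apply: pd_conj => //; apply: pdZ => //; exact: pd1.
have pT : pdmx T.
  rewrite -(subrK (iota a *: 1%:M) T) addrC; apply: pdD => //.
  by apply: pdZ => //; exact: pd1.
rewrite !E (det_monotone pa _).1 ?(det_monotone (pd_conj rX pT) _).1//;
  exact: psd_sub_conj.
Qed.

(** The left side is a single term of the Cauchy-Binet expansion of the right side. It is isolated
    by replacing the diagonal entries outside the image of [f] by 0, which lowers the form. *)
Lemma det_rowsub_le n r (A : 'M[F]_n) (d : 'rV[R]_n) (X : 'M[F]_(n, r))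
    (f : 'I_r -> 'I_n) :
  injective f -> (forall i, 0 < d 0 i) -> \det (rowsub f (A *m X)) != 0 ->
  iota (\prod_i d 0 (f i)) * `|\det (rowsub f (A *m X))| ^+ 2 <=
  \det (X^H *m (A^H *m diag_mx (map_mx iota d) *m A) *m X).
Proof.
move=> fi d0 dY; set Y := rowsub _ _.
pose df : 'rV[R]_r := \row_i d 0 (f i).
have <- : \det (Y^H *m diag_mx (map_mx iota df) *m Y) =
    iota (\prod_i d 0 (f i)) * `|\det Y| ^+ 2.
  rewrite !det_mulmx det_adjmx mulrAC conj_scalarM det_diag mulrC rmorph_prod.
  by congr (_ * _); apply: eq_bigr => i _; rewrite !mxE.
have pdf : pdmx (diag_mx (map_mx iota df)) by apply: pd_diag => i; rewrite mxE.
have uY : Y \in unitmx by rewrite unitmxE unitfE.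
apply: (det_monotone _ _).1; first by apply: pd_conj => //; rewrite mxrank_unit.
have -> : Y = rowsub f 1%:M *m (A *m X) by rewrite -rowsubE.
have -> : X^H *m (A^H *m diag_mx (map_mx iota d) *m A) *m X =
    (A *m X)^H *m diag_mx (map_mx iota d) *m (A *m X).
  by rewrite adjmxM !mulmxA.
set D := diag_mx (map_mx iota df).
have -> : (rowsub f 1%:M *m (A *m X))^H *m D *m (rowsub f 1%:M *m (A *m X)) =
    (A *m X)^H *m ((rowsub f 1%:M)^H *m D *m rowsub f 1%:M) *m (A *m X).
  by rewrite adjmxM !mulmxA.
apply: psd_sub_conj; rewrite /D.
have -> : (rowsub f 1%:M)^H *m diag_mx (map_mx iota df) *m rowsub f 1%:M =
    diag_mx (map_mx iota (\row_i (if i \in codom f then d 0 i else 0))).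
  apply/matrixP => a b; rewrite !mxE.
  under eq_bigr do rewrite mul_mx_diag !mxE.
  case: ifPn => [/codomP[i ->]|/codomP aN].
    rewrite (bigD1 i)//= big1 ?addr0 => [|i' i'i]; last first.
      by rewrite (inj_eq fi) (negbTE i'i) rmorph0 !mul0r.
    by rewrite eqxx rmorph1 mul1r mulr_natr.
  rewrite rmorph0 mul0rn big1// => i _.
  case: eqP => [fia|_]; last by rewrite rmorph0 !mul0r.
  by case: aN; exists i.
rewrite -linearB /= -map_mxB; apply: psd_diag => i; rewrite !mxE.
by case: ifP; rewrite ?subrr// subr0 ltW.
Qed.

End bounds.

(** * Pivot rows *)

Section pivot_rows.
Variable F : fieldType.

(** The upper rows are zeroed rather than removed, so that the type does not depend on [j]. *)
Definition lower_rows m r j (Y : 'M[F]_(m, r)) : 'M[F]_(m, r) :=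
  \matrix_(i, l) (if (j <= i)%N then Y i l else 0).

(* Choosing the pivot rows from the bottom up makes every trailing block of rows
   contain as many of them as its rank allows. *)
Lemma pivot_rows m r (Y : 'M[F]_(m, r)) : \rank Y = r ->
  exists f : 'I_r -> 'I_m, [/\ injective f, \det (rowsub f Y) != 0 &
    forall j : nat,
      (\rank (lower_rows j Y) <= #|[pred i | (j <= f i)%N]|)%N].
Proof.
move=> rY; pose S (s : {set 'I_m}) := (\sum_(i in s) <<row i Y>>)%MS.
have Sm (i : 'I_m) (s : {set 'I_m}) : i \in s -> (row i Y <= S s)%MS.
  by move=> si; rewrite (sumsmx_sup i)// genmxE.
have Ss (s t : {set 'I_m}) : s \subset t -> (S s <= S t)%MS.
  move=> /fintype.subsetP st; apply/sumsmx_subP => i /st ti.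
  by rewrite genmxE Sm.
have rS s : (\rank (S s) <= #|s|)%N.
  apply: leq_trans (mxrank_sum_leqif _).1 _ => /=.
  rewrite -sum1_card; apply: leq_sum => i _; rewrite genmxE; exact: rank_leq_row.
pose up j := [set i : 'I_m | (j <= i)%N]%SET.
(* The pivots are the rows that are not spanned by the rows below them; those in a trailing block
   form a basis of its row space. *)
pose J := [set i : 'I_m | ~~ (row i Y <= S (up i.+1))%MS]%SET.
have rowJ : forall n (i : 'I_m), (m - i <= n)%N ->
    (row i Y <= S (J :&: up i)%SET)%MS.
  elim=> [|n IH] i; first by rewrite leqn0 subn_eq0 leqNgt ltn_ord.
  move=> mi; have [iJ|] := boolP (i \in J).
    by apply: Sm; rewrite !inE leqnn andbT; move: iJ; rewrite inE.
  rewrite inE negbK => /submx_trans; apply; apply/sumsmx_subP => i'.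
  rewrite inE => ii'; rewrite genmxE; apply: submx_trans (IH i' _) _.
    by rewrite -ltnS (leq_trans _ mi)// ltn_sub2l.
  by apply: Ss; apply: finset.setIS; apply/fintype.subsetP => l; rewrite !inE; apply/leq_trans/ltnW.
have upJ j : (S (up j) <= S (J :&: up j)%SET)%MS.
  apply/sumsmx_subP => i; rewrite inE genmxE => ji.
  apply: submx_trans (rowJ _ i (leqnn _)) _; apply: Ss; apply: finset.setIS.
  by apply/fintype.subsetP => l; rewrite !inE; exact: leq_trans.
have lowS j : (lower_rows j Y <= S (up j))%MS.
  apply/row_subP => i; have [ji|ji] := boolP (j <= i)%N.
    have -> : row i (lower_rows j Y) = row i Y.
      by apply/rowP => l; rewrite !mxE ji.
    by apply: Sm; rewrite inE.
  have -> : row i (lower_rows j Y) = 0.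
    by apply/rowP => l; rewrite !mxE (negbTE ji).
  exact: sub0mx.
(* Going upwards, each pivot strictly increases the rank, so pivots cannot outnumber it. *)
have cardJ : forall n j, (m - j <= n)%N -> (#|(J :&: up j)%SET| <= \rank (S (up j)))%N.
  elim=> [|n IH] j mj.
    have -> : (J :&: up j = finset.set0)%SET; last by rewrite cards0.
    apply/finset.setP => i; rewrite !inE andbC leqNgt (leq_trans (ltn_ord i))//.
    by rewrite -subn_eq0 -leqn0.
  have [jm|mj'] := ltnP j m; last first.
    by apply: IH; move: mj'; rewrite -subn_eq0 => /eqP ->.
  have := IH j.+1; rewrite -ltnS subnS prednK ?subn_gt0// => /(_ mj) IHj.
  pose i := Ordinal jm.
  have upS : (up j = i |: up j.+1)%SET.
    by apply/finset.setP => l; rewrite !inE -val_eqE /= leq_eqVlt eq_sym.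
  have Sle : (S (up j.+1) <= S (up j))%MS by apply: Ss; rewrite upS finset.subsetUr.
  have [iJ|iJ] := boolP (i \in J); last first.
    apply: leq_trans (mxrankS Sle); apply: leq_trans IHj.
    apply: subset_leq_card; rewrite upS finset.setIUr finset.subUset fintype.subxx andbT.
    apply/fintype.subsetP => l; rewrite !inE => /andP[+ /eqP e]; rewrite e.
    by move: iJ; rewrite inE => /negbTE ->.
  have lt : (S (up j.+1) < S (up j))%MS.
    rewrite /ltmx Sle /=; apply: contraL iJ => h; rewrite inE negbK.
    by apply: submx_trans h; apply: Sm; rewrite inE.
  have ltr : (\rank (S (up j.+1)) < \rank (S (up j)))%N.
    by move: lt; rewrite ltmxErank => /andP[].
  apply: leq_trans ltr.
  have -> : (J :&: up j = i |: (J :&: up j.+1))%SET.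
    by rewrite upS finset.setIUr; congr (_ :|: _)%SET; apply/finset.setIidPr; rewrite finset.sub1set.
  by rewrite cardsU1 !inE ltnn andbF add1n ltnS.
have J_r : #|J| = r.
  have S0 : (S (up 0) :=: Y)%MS.
    apply/eqmxP/andP; split; first by apply/sumsmx_subP => i _; rewrite genmxE row_sub.
    by apply/row_subP => i; apply: Sm; rewrite inE.
  have up0 : (J :&: up 0 = J)%SET by apply/finset.setIidPl/fintype.subsetP => i; rewrite !inE.
  apply/eqP; rewrite eqn_leq; apply/andP; split.
    by rewrite -{1}up0 (leq_trans (cardJ _ 0 (leqnn _)))// S0 rY.
  by rewrite -{1}rY -S0 (leq_trans (mxrankS (upJ 0)))// up0.
pose f (i : 'I_r) : 'I_m := enum_val (cast_ord (esym J_r) i).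
have fi : injective f by move=> i j /enum_val_inj/cast_ord_inj.
have fJ j : j \in J -> exists i, f i = j.
  move=> jJ; exists (cast_ord J_r (enum_rank_in jJ j)).
  by rewrite /f cast_ordK enum_rankK_in.
exists f; split => //.
- rewrite -unitfE -unitmxE -row_full_unit /row_full eqn_leq rank_leq_col /=.
  rewrite -{1}rY -{1}(_ : lower_rows 0 Y = Y); last by apply/matrixP => i j; rewrite mxE.
  apply: mxrankS; apply: submx_trans (lowS 0) _.
  apply: submx_trans (upJ 0) _; apply/sumsmx_subP => j; rewrite inE => /andP[jJ _].
  rewrite genmxE; have [i <-] := fJ _ jJ.
  by rewrite (_ : row (f i) Y = row i (rowsub f Y)) ?row_sub//; apply/rowP => l; rewrite !mxE.
- move=> j; apply: leq_trans (mxrankS (submx_trans (lowS j) (upJ j))) _.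
  apply: leq_trans (rS _) _; rewrite -[X in (_ <= X)%N](card_imset _ fi).
  apply: subset_leq_card; apply/fintype.subsetP => l; rewrite inE => /andP[/fJ[i <-]].
  by rewrite inE => jf; apply: imset_f; rewrite inE.
Qed.

End pivot_rows.

(** * Pencils and ranges of matrices *)

Section pencil.
Variable R : realType.

(** A complex eigenvalue exists by algebraic closedness. Symmetry makes it real, and then the real
    or the imaginary part of the eigenvector is a real one. *)
Lemma real_pencil_root n (M B : 'M[R]_n) : (0 < n)%N -> pdmx (k := Reals) M ->
  B^T = B -> exists a, \det (B - a *: M) = 0.
Proof.
move=> n0 pM sB; have uM : M \in unitmx := pd_unit pM.
have [aM qM] := pM.
have sM : M^T = M by rewrite -[RHS]aM; apply/matrixP => i j; rewrite !mxE.
have {}qM (x : 'rV[R]_n) : x != 0 -> 0 < (x *m M *m x^T) 0 0.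
  move=> x0; have := qM x^T; rewrite -(inj_eq (@trmx_inj _ _ _)) trmxK trmx0.
  move=> /(_ x0); congr (0 < (_ *m _ *m _) 0 0).
  by apply/matrixP => i j; rewrite !mxE.
pose toC := map_mx (real_complex R) : 'M[R]_n -> 'M[R[i]]_n.
have [[al be] /eigenvalueP[v + v0]] := eigenvalue_closed (toC B *m invmx (toC M)) n0.
move=> /(congr1 (mulmx^~ (toC M))); rewrite mulmxA mulmxKV ?map_unitmx// -scalemxAl.
have ReM (N : 'M[R]_n) : map_mx (@complex.Re R) (v *m toC N) = map_mx (@complex.Re R) v *m N.
  apply/matrixP => i j; rewrite !mxE.
  rewrite (big_morph (@complex.Re R) (id1 := 0) (op1 := +%R)); [|by case=> ? ? []|by []].
  apply: eq_bigr => l _; rewrite !mxE; case: (v i l) => ? ? /=.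
  by rewrite mulr0 subr0.
have ImM (N : 'M[R]_n) : map_mx (@complex.Im R) (v *m toC N) = map_mx (@complex.Im R) v *m N.
  apply/matrixP => i j; rewrite !mxE.
  rewrite (big_morph (@complex.Im R) (id1 := 0) (op1 := +%R)); [|by case=> ? ? []|by []].
  apply: eq_bigr => l _; rewrite !mxE; case: (v i l) => ? ? /=.
  by rewrite mulr0 add0r.
have ReZ (w : 'rV[R[i]]_n) : map_mx (@complex.Re R) ((al +i* be)%C *: w) =
    al *: map_mx (@complex.Re R) w - be *: map_mx (@complex.Im R) w.
  by apply/matrixP => i j; rewrite !mxE; case: (w i j).
have ImZ (w : 'rV[R[i]]_n) : map_mx (@complex.Im R) ((al +i* be)%C *: w) =
    al *: map_mx (@complex.Im R) w + be *: map_mx (@complex.Re R) w.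
  by apply/matrixP => i j; rewrite !mxE; case: (w i j).
move=> vB; have := congr1 (map_mx (@complex.Im R)) vB.
have := congr1 (map_mx (@complex.Re R)) vB.
rewrite (ReZ (v *m toC M)) (ImZ (v *m toC M)) (ReM B) (ImM B) (ReM M) (ImM M).
have xy0 : map_mx (@complex.Re R) v != 0 \/ map_mx (@complex.Im R) v != 0.
  have [x0|] := eqVneq (map_mx (@complex.Re R) v) 0; last by left.
  right; apply: contra_neq v0 => y0; apply/matrixP => i j.
  have := congr1 (fun w : 'rV_n => w i j) x0; have := congr1 (fun w : 'rV_n => w i j) y0.
  by rewrite !mxE; case: (v i j) => ? ? /= -> ->.
move: (map_mx _ v) (map_mx _ v) xy0 => x y xy0 xB yB.
have q_ge0 (u : 'rV[R]_n) : 0 <= (u *m M *m u^T) 0 0.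
  by have [->|/qM/ltW//] := eqVneq u 0; rewrite !mul0mx mxE.
have symE (N : 'M[R]_n) : N^T = N -> (x *m N *m y^T) 0 0 = (y *m N *m x^T) 0 0.
  by move=> sN; rewrite -[in LHS](trmxK (x *m N *m y^T)) mxE !trmx_mul trmxK sN mulmxA.
have := symE _ sB; rewrite xB yB mulmxBl mulmxDl -!scalemxAl.
have := symE _ sM; have := q_ge0 x; have := q_ge0 y.
have qx : x != 0 -> 0 < (x *m M *m x^T) 0 0 by exact: qM.
have qy : y != 0 -> 0 < (y *m M *m y^T) 0 0 by exact: qM.
have entD (A C : 'M[R]_1) a c : (a *: A + c *: C) 0 0 = a * A 0 0 + c * C 0 0.
  by rewrite !mxE.
rewrite -scaleNr !entD; move: qx qy.
move: ((x *m M *m x^T) 0 0) ((y *m M *m y^T) 0 0) => qx qy qx0 qy0.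
move: ((x *m M *m y^T) 0 0) ((y *m M *m x^T) 0 0) => b1 b2 qy1 qx1 -> e.
(* With [x] and [y] the two parts of the eigenvector, [x *m B *m y^T] and [y *m B *m x^T] agree. The
   terms in [al] cancel, which leaves [be] times a positive number. *)
have be0 : be = 0.
  have /eqP : be * (qx + qy) = 0 by move: e; rewrite mulNr mulrDr => e; lra.
  rewrite mulf_eq0 => /orP[/eqP//|]; rewrite paddr_eq0// => /andP[/eqP x0 /eqP y0].
  by case: xy0 => [/qy0|/qx0]; rewrite ?x0 ?y0 ltxx.
exists al; apply/eqP/det0P; case: xy0 => u0; [exists y|exists x] => //.
  by rewrite mulmxBr xB be0 scale0r subr0 -scalemxAr subrr.
by rewrite mulmxBr yB be0 scale0r addr0 -scalemxAr subrr.
Qed.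

Lemma pencil_root k n (M B : 'M[scalar_field R k]_n) : (0 < n)%N -> pdmx M ->
  B^H = B -> exists a, \det (B - a *: M) = 0.
Proof.
case: k M B => M B n0 pM sB.
  apply: real_pencil_root => //.
  by rewrite -[RHS]sB; apply/matrixP => i j; rewrite !mxE.
have uM : M \in unitmx := pd_unit pM.
have [a /eigenvalueP[v vB v0]] := eigenvalue_closed (B *m invmx M : 'M[R[i]]_n) n0.
exists a; apply/eqP/det0P; exists v => //.
rewrite mulmxBr -scalemxAr scalemxAl -vB; apply/eqP; rewrite subr_eq0; apply/eqP.
by rewrite mulmxA mulmxKV.
Qed.

End pencil.

Section ranges.
Variables (R : realType) (k : scalars) (m : nat).
Local Notation F := (scalar_field R k).

Lemma dim_colvec : \dim (fullv : {vspace 'cV[F]_m}) = m.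
Proof. by rewrite dimvf dim_matrix; exact: muln1. Qed.

Lemma mxrangeP n (X : 'M[F]_(m, n)) (v : 'cV[F]_m) :
  reflect (exists c, v = X *m c) (v \in mxrange X).
Proof.
rewrite /mxrange; apply: (iffP idP) => [/memv_imgP[c _ ->]|[c ->]].
  by exists c; rewrite lfunE.
by apply/memv_imgP; exists c; rewrite ?memvf ?lfunE.
Qed.

Lemma dim_mxrange n (X : 'M[F]_(m, n)) : \dim (mxrange X) = \rank X.
Proof.
have XE := mulmx_base X; set r := \rank X in XE *.
have -> : mxrange X = mxrange (col_base X).
  apply/vspaceP => v; apply/mxrangeP/mxrangeP => -[c ->].
    by exists (row_base X *m c); rewrite mulmxA XE.
  have /row_freeP [W WE] := row_base_free X.
  exists (W *m c); transitivity (col_base X *m row_base X *m (W *m c)).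
    by rewrite -mulmxA (mulmxA _ W) WE mul1mx.
  by rewrite XE.
rewrite /mxrange limg_dim_eq ?dimvf ?dim_matrix; first exact: muln1.
apply/vspaceP => c; rewrite memv_cap memvf /= memv_ker lfunE /= memv0.
apply/eqP/eqP => [|->]; last by rewrite mulmx0.
by apply: rank_mulmx_inj; exact/eqP/col_base_full.
Qed.

Lemma mxrange_sub n p (X : 'M[F]_(m, n)) (Y : 'M[F]_(m, p)) :
  (mxrange X <= mxrange Y)%VS -> exists W, X = Y *m W.
Proof.
move=> /subvP XY; have /choice[w wE] j : exists w : 'cV_p, col j X = Y *m w.
  by apply/mxrangeP/XY/mxrangeP; exists (delta_mx j 0); rewrite colE.
exists (\matrix_(i, j) w j i 0); apply/matrixP => i j.
have := congr1 (fun u : 'cV_m => u i 0) (wE j); rewrite !mxE => ->.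
by apply: eq_bigr => l _; rewrite mxE.
Qed.

Lemma mxrange_mul n (B : 'M[F]_m) (X : 'M[F]_(m, n)) :
  (linfun (mulmx B) @: mxrange X)%VS = mxrange (B *m X).
Proof.
apply/vspaceP => v; apply/memv_imgP/mxrangeP => [[u /mxrangeP[c ->] ->]|[c ->]].
  by exists c; rewrite lfunE /= mulmxA.
by exists (X *m c); [apply/mxrangeP; exists c|rewrite lfunE /= mulmxA].
Qed.

Lemma mxrange_row n p (X : 'M[F]_(m, n)) (Y : 'M[F]_(m, p)) :
  mxrange (row_mx X Y) = (mxrange X + mxrange Y)%VS.
Proof.
apply/vspaceP => v; apply/mxrangeP/memv_addP => [[c ->]|[u /mxrangeP[a ->]]].
  rewrite -(vsubmxK c) mul_row_col; exists (X *m usubmx c).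
    by apply/mxrangeP; eexists.
  by exists (Y *m dsubmx c) => //; apply/mxrangeP; eexists.
by move=> [_ /mxrangeP[b ->] ->]; exists (col_mx a b); rewrite mul_row_col.
Qed.

Lemma vspace_mxrange (V : {vspace 'cV[F]_m}) :
  exists2 Q : 'M[F]_(m, \dim V), \rank Q = \dim V & mxrange Q = V.
Proof.
pose Q : 'M[F]_(m, \dim V) := \matrix_(i, j) (vbasis V)`_j i 0.
have QV : mxrange Q = V.
  have QE c : Q *m c = \sum_(j < \dim V) c j 0 *: (vbasis V)`_j.
    apply/matrixP => i l; rewrite ord1 mxE summxE; apply: eq_bigr => j _.
    by rewrite !mxE mulrC.
  apply/vspaceP => v; apply/mxrangeP/idP => [[c ->]|vV].
    rewrite QE memv_suml// => j _; apply: memvZ; apply: vbasis_mem.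
    by rewrite mem_nth// size_tuple.
  exists (\col_j coord (vbasis V) j v); rewrite QE {1}(coord_vbasis vV).
  by apply: eq_bigr => j _; rewrite mxE.
by exists Q => //; rewrite -dim_mxrange QV.
Qed.

(** The columns of [a] and [b] are the coordinates of one basis of the intersection in terms of [X]
    and of [Q]. *)
Lemma mxrange_cap n p (X : 'M[F]_(m, n)) (Q : 'M[F]_(m, p)) :
  let d := \dim (mxrange X :&: mxrange Q)%VS in
  exists (a : 'M[F]_(n, d)) (b : 'M[F]_(p, d)),
  [/\ X *m a = Q *m b, \rank a = d & \rank b = d].
Proof.
move=> d; have [Z rZ ZE] := vspace_mxrange (mxrange X :&: mxrange Q)%VS.
have /mxrange_sub [a Za] : (mxrange Z <= mxrange X)%VS by rewrite ZE capvSl.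
have /mxrange_sub [b Zb] : (mxrange Z <= mxrange Q)%VS by rewrite ZE capvSr.
exists a, b; split; first by rewrite -Za.
  apply/eqP; rewrite eqn_leq rank_leq_col /=.
  by rewrite -[X in (X <= _)%N]rZ {1}Za mxrankM_maxr.
apply/eqP; rewrite eqn_leq rank_leq_col /=.
by rewrite -[X in (X <= _)%N]rZ {1}Zb mxrankM_maxr.
Qed.

(** For fixed [N1] and [N2] the determinant is a polynomial in [X], so a lower bound on the rank is
    an open condition. The witnesses come from the rank normal form. *)
Lemma rank_geP n (X : 'M[F]_(m, n)) s : (s <= \rank X)%N <->
  exists (N1 : 'M[F]_(s, m)) (N2 : 'M[F]_(n, s)), \det (N1 *m X *m N2) != 0.
Proof.
split=> [sX|[N1 [N2]]]; last first.
  rewrite -unitfE -unitmxE => /mxrank_unit <-.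
  by apply: leq_trans (mxrankM_maxl _ _) _; exact: mxrankM_maxr.
have uL := col_ebase_unit X; have uU := row_ebase_unit X.
exists (pid_mx s *m invmx (col_ebase X)), (invmx (row_ebase X) *m pid_mx s).
rewrite -{2}(mulmx_ebase X) -!mulmxA mulKVmx// mulKmx// !mul_pid_mx.
have rm := leq_trans sX (rank_leq_row X); have rn := leq_trans sX (rank_leq_col X).
rewrite (minn_idPr sX) ?(minn_idPr rm) ?(minn_idPl sX) ?(minn_idPl rn) ?minnn.
by rewrite (minn_idPr rn) minnn (minn_idPr rm) pid_mx_1 det1 oner_eq0.
Qed.

Lemma dim_cap_leP n p (X : 'M[F]_(m, n)) (Q : 'M[F]_(m, p)) s :
  \rank X = n -> \rank Q = p ->
  (\dim (mxrange X :&: mxrange Q) <= s)%N =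
  (n + p - s <= \rank (row_mx X Q))%N.
Proof.
move=> rX rQ; have := dimv_sum_cap (mxrange X) (mxrange Q).
rewrite -mxrange_row !dim_mxrange rX rQ; move: (\rank _) => q e.
by rewrite leq_subLR -e addnC leq_add2r.
Qed.

Lemma kernel_range_split (A B : 'M[F]_m) : (0 < m)%N -> pdmx A -> pdmx B ->
  \det A = 1 -> \det B = 1 -> A != B ->
  exists E W : {vspace 'cV[F]_m},
  [/\ E != 0%VS /\ E != fullv, W != 0%VS /\ W != fullv,
      (\dim E + \dim W = m)%N &
      forall n (X : 'M[F]_(m, n)) (Y : 'M[F]_n),
        invmx (A + B) *m B *m X = X *m Y ->
        (\dim (mxrange X) <=
         \dim (mxrange X :&: E) + \dim (mxrange X :&: W))%N].
Proof.
move=> m0 pA pB dA dB AB; have pM : pdmx (A + B) by exact/pdD/pd_psd.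
have [a da] := pencil_root m0 pM (proj1 pB).
pose C := invmx (A + B) *m B - a%:M.
have CE : C = invmx (A + B) *m (B - a *: (A + B)).
  by rewrite mulmxBr -scalemxAr mulVmx ?pd_unit// scalemx1.
(* Otherwise [B = a *: (A + B)]. The forms at one vector put [a] strictly between 0 and 1, so [B] is
   a nonnegative multiple of [A], and equal determinants force the factor 1. *)
have C0 : C != 0.
  apply/eqP => C0; have eB : B = a *: (A + B).
    apply/eqP; rewrite -subr_eq0; apply/eqP.
    by rewrite -(mulKVmx (pd_unit pM) (B - _)) -CE C0 mulmx0.
  pose x : 'cV[F]_m := delta_mx (Ordinal m0) 0.
  have x0 : x != 0.
    apply/eqP => /matrixP/(_ (Ordinal m0) 0); rewrite !mxE !eqxx => /eqP.
    by rewrite oner_eq0.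
  have qA := pA.2 x x0; have qB := pB.2 x x0.
  have qE : (x^H *m B *m x) 0 0 =
      a * ((x^H *m A *m x) 0 0 + (x^H *m B *m x) 0 0).
    rewrite {1}eB -scalemxAr -scalemxAl mulmxDr mulmxDl.
    by rewrite [LHS]mxE [X in a * X]mxE.
  have qAB := addr_gt0 qA qB.
  have a_gt0 : 0 < a by rewrite -(pmulr_lgt0 _ qAB) -qE.
  have a_lt1 : a < 1.
    by rewrite -(ltr_pM2r qAB) -qE mul1r ltrDr.
  have eBA : B = (a / (1 - a)) *: A.
    have a1 : 1 - a != 0 by rewrite subr_eq0 gt_eqF.
    apply: (scalerI a1); rewrite scalerA mulrCA divff// mulr1 scalerBl scale1r.
    by apply/eqP; rewrite subr_eq -scalerDr -eB.
  have c_ge0 : 0 <= a / (1 - a) by rewrite divr_ge0 ?subr_ge0 ?ltW.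
  have := dB; rewrite eBA detZ dA mulr1 => /eqP.
  rewrite pexpr_eq1// => /eqP c1.
  by move: AB; rewrite eBA c1 scale1r eqxx.
pose f : 'End('cV[F]_m) := linfun (mulmx C).
have E0 : lker f != 0%VS.
  have : \det C^T == 0 by rewrite det_tr CE det_mulmx da mulr0.
  move=> /det0P[v v0 vC]; apply: contra v0 => /eqP K0.
  have : v^T \in lker f.
    by rewrite memv_ker lfunE /= -[C]trmxK -trmx_mul vC trmx0.
  by rewrite K0 memv0 => /eqP vT0; rewrite -[v]trmxK vT0 trmx0.
have EF : lker f != fullv.
  apply: contra C0 => /eqP KF; apply/eqP/matrixP => i j.
  have : delta_mx j 0 \in lker f by rewrite KF memvf.
  rewrite memv_ker lfunE /= -colE => /eqP/matrixP/(_ i 0).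
  by rewrite !mxE.
have := limg_ker_dim f fullv; rewrite capfv dim_colvec => dimE.
(* An invariant subspace is mapped by [f] into itself, so rank-nullity on it only
   involves its intersections with the kernel and the range of [f]. *)
exists (lker f), (limg f); split => //.
- split; apply/eqP => W0; rewrite W0 in dimE.
    move/eqP: EF; apply; apply/eqP; rewrite eqEdim subvf dim_colvec -[X in (X <= _)%N]dimE.
    by rewrite dimv0 addn0 leqnn.
  move: E0; rewrite -dimv_eq0; move/eqP: dimE.
  by rewrite dim_colvec -[X in _ == X]add0n eqn_add2r => /eqP ->.
- move=> n X Y XY; rewrite -(limg_ker_dim f (mxrange X)) leq_add2l.
  apply: dimvS; rewrite subv_cap limgS ?subvf// andbT.
  rewrite mxrange_mul; apply/subvP => v /mxrangeP[c ->]; apply/mxrangeP.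
  exists ((Y - a%:M) *m c); rewrite mulmxBl XY !mulmxA; congr (_ *m c).
  by rewrite mulmxBr mul_mx_scalar mul_scalar_mx.
Qed.

End ranges.

(** * Limits of matrices *)

Section continuity.
Variables (R : realType) (k : scalars).
Local Notation F := (scalar_field R k).
Local Notation iota := (real_scalar R k).

Lemma re_scalar_continuous : continuous (@re_scalar R k : F -> R).
Proof.
move=> x; apply/(@cvgrPdist_lt R R _ (nbhs x) (nbhs_filter x)) => e e0; near=> y.
rewrite -(ltr_real_scalar k) -re_scalarN -re_scalarD.
apply: le_lt_trans (re_scalar_le_norm _) _; near: y.
have ie0 : 0 < iota e by rewrite -(rmorph0 iota) ltr_real_scalar.
by move/cvgrPdist_lt : (@cvg_id _ (nbhs x)); apply.
Unshelve. all: by end_near. Qed.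

Lemma conj_scalar_continuous : continuous (conj_scalar R k : F -> F).
Proof.
move=> x; apply/(@cvgrPdist_lt F F _ (nbhs x) (nbhs_filter x)) => e e0; near=> y.
rewrite -rmorphB norm_conj_scalar; near: y.
by move/cvgrPdist_lt : (@cvg_id _ (nbhs x)); apply.
Unshelve. all: by end_near. Qed.

Lemma real_scalar_continuous : continuous (iota : R -> F).
Proof.
move=> x; apply/(@cvgrPdist_lt F F _ (nbhs x) (nbhs_filter x)) => e e0; near=> y.
have -> : e = iota (re_scalar e) by rewrite real_scalar_re// ge0_conj_scalar// ltW.
rewrite -rmorphB norm_real_scalar ltr_real_scalar; near: y.
have re0 : 0 < re_scalar e by have := ltr_re_scalar e0; rewrite -(rmorph0 iota) re_real_scalar.
by move/cvgrPdist_lt : (@cvg_id _ (nbhs x)); apply.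
Unshelve. all: by end_near. Qed.

Section limits.
Variables (T : Type) (G : set_system T).
Context {FG : Filter G}.
Implicit Types (n m p : nat).

(** Entrywise convergence along an arbitrary filter serves both for sequences and for continuity at
    a matrix. *)
Definition mx_cvg m n (A : T -> 'M[F]_(m, n)) (L : 'M[F]_(m, n)) :=
  forall i j, A t i j @[t --> G] --> L i j.

Lemma mx_cvg_cst m n (L : 'M[F]_(m, n)) : mx_cvg (fun=> L) L.
Proof. by move=> i j; exact: cvg_cst. Qed.

Lemma mx_cvgM m n p (A : T -> 'M[F]_(m, n)) (B : T -> 'M[F]_(n, p)) L K :
  mx_cvg A L -> mx_cvg B K -> mx_cvg (fun t => A t *m B t) (L *m K).
Proof.
move=> AL BK i j; rewrite mxE; under eq_fun do rewrite mxE.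
by apply: cvg_big => [|l _]; [exact: add_continuous|exact: cvgM].
Qed.

Lemma mx_cvg_adj m n (A : T -> 'M[F]_(m, n)) L :
  mx_cvg A L -> mx_cvg (fun t => (A t)^H) L^H.
Proof.
move=> AL i j; rewrite !mxE; under eq_fun do rewrite !mxE.
exact: cvg_comp (AL j i) (@conj_scalar_continuous _).
Qed.

Lemma cvg_det n (A : T -> 'M[F]_n) L :
  mx_cvg A L -> \det (A t) @[t --> G] --> \det L.
Proof.
move=> AL; rewrite /determinant.
apply: cvg_big => [|s _]; first exact: add_continuous.
apply: cvgM; first exact: cvg_cst.
by apply: cvg_big => [|l _]; [exact: mul_continuous|exact: AL].
Qed.

Lemma mx_cvg_rowsub m n p (A : T -> 'M[F]_(m, n)) L (f : 'I_p -> 'I_m) :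
  mx_cvg A L -> mx_cvg (fun t => rowsub f (A t)) (rowsub f L).
Proof. by move=> AL i j; rewrite !mxE; under eq_fun do rewrite !mxE; exact: AL. Qed.

Lemma mx_cvg_diag n (d : T -> 'rV[R]_n) (l : 'rV[R]_n) :
  (forall i, d t 0 i @[t --> G] --> l 0 i) ->
  mx_cvg (fun t => diag_mx (map_mx iota (d t))) (diag_mx (map_mx iota l)).
Proof.
move=> dl i j; rewrite !mxE; under eq_fun do rewrite !mxE.
case: eqP => _; last exact: cvg_cst.
exact: cvg_comp (dl i) (@real_scalar_continuous _).
Qed.

End limits.

End continuity.

(** * Expectation of bounded functions *)

Section bounded_expectation.
Context d (T : measurableType d) (R : realType) (P : probability T R).
Local Notation E f := (\int[P]_x f x).
Implicit Types f g h : T -> R.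

(** Such functions are integrable for a probability and closed under the operations below, so that
    means can be handled as real numbers. *)
Definition bounded_measurable f :=
  measurable_fun setT f /\ exists c : R, forall x, `|f x| <= c.

Lemma bounded_measurable_integrable f : bounded_measurable f ->
  P.-integrable setT (EFin \o f).
Proof.
move=> [mf [c fc]]; apply: measurable_bounded_integrable => //.
  by rewrite ltey_eq fin_num_measure.
exists c; split; first exact: num_real.
by move=> y cy x _ /=; exact: le_trans (fc x) (ltW cy).
Qed.

Lemma bounded_measurable_cst c : bounded_measurable (fun=> c).
Proof. by split; [exact: measurable_cst|exists `|c|]. Qed.

Lemma bounded_measurableD f g : bounded_measurable f -> bounded_measurable g ->
  bounded_measurable (fun x => f x + g x).
Proof.
move=> [mf [a fa]] [mg [b gb]]; split; first exact: measurable_funD.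
by exists (a + b) => x; rewrite (le_trans (ler_normD _ _))// lerD.
Qed.

Lemma bounded_measurableZ a f : bounded_measurable f ->
  bounded_measurable (fun x => a * f x).
Proof.
move=> [mf [c fc]]; split.
  by apply: measurable_funM => //; exact: measurable_cst.
by exists (`|a| * c) => x; rewrite normrM ler_wpM2l.
Qed.

Lemma bounded_measurable_max f g : bounded_measurable f -> bounded_measurable g ->
  bounded_measurable (fun x => Num.max (f x) (g x)).
Proof.
move=> [mf [a fa]] [mg [b gb]]; split; first exact: measurable_maxr.
exists (Num.max a b) => x; rewrite le_max; apply/orP.
by rewrite /Num.max; case: ifP => _; [right|left].
Qed.

Lemma bounded_measurable_min f g : bounded_measurable f -> bounded_measurable g ->
  bounded_measurable (fun x => Num.min (f x) (g x)).
Proof.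
move=> [mf [a fa]] [mg [b gb]]; split; first exact: measurable_minr.
exists (Num.max a b) => x; rewrite le_max; apply/orP.
by rewrite /Num.min; case: ifP => _; [left|right].
Qed.

Lemma bounded_measurable_sum (I : Type) (s : seq I) (f : I -> T -> R) :
  (forall i, bounded_measurable (f i)) ->
  bounded_measurable (fun x => \sum_(i <- s) f i x).
Proof.
move=> bf; elim: s => [|i s IH].
  by under eq_fun do rewrite big_nil; exact: bounded_measurable_cst.
by under eq_fun do rewrite big_cons; exact: bounded_measurableD.
Qed.

Lemma expectation_cst c : E (fun=> c) = c.
Proof.
rewrite Rintegral_cst// -[RHS]mulr1; congr (_ * _).
by rewrite -[RHS]/(fine 1%E) -(probability_setT P).
Qed.

Lemma expectationD f g : bounded_measurable f -> bounded_measurable g ->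
  E (fun x => f x + g x) = E f + E g.
Proof. by move=> bf bg; rewrite RintegralD//; exact: bounded_measurable_integrable. Qed.

Lemma expectationZ a f : bounded_measurable f ->
  E (fun x => a * f x) = a * E f.
Proof. by move=> bf; rewrite RintegralZl//; exact: bounded_measurable_integrable. Qed.

Lemma expectation_sum (I : Type) (s : seq I) (f : I -> T -> R) :
  (forall i, bounded_measurable (f i)) ->
  E (fun x => \sum_(i <- s) f i x) = \sum_(i <- s) E (f i).
Proof.
move=> bf; elim: s => [|i s IH].
  by rewrite big_nil; under eq_Rintegral do rewrite big_nil; exact: expectation_cst.
rewrite big_cons; under eq_Rintegral do rewrite big_cons.
by rewrite expectationD ?IH//; exact: bounded_measurable_sum.
Qed.

Lemma le_expectation f g : bounded_measurable f -> bounded_measurable g ->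
  (forall x, f x <= g x) -> E f <= E g.
Proof. by move=> bf bg fg; apply: le_Rintegral => //; exact: bounded_measurable_integrable. Qed.

Lemma EFin_expectation f : bounded_measurable f ->
  (\int[P]_x (f x)%:E = (E f)%:E)%E.
Proof.
move=> bf; rewrite /Rintegral fineK//.
exact/integrable_fin_num/bounded_measurable_integrable.
Qed.

(** A nonnegative [f] with mean at most 0 vanishes almost everywhere. Replacing [h] by its maximum
    with [g] then keeps its mean and makes the inequality hold everywhere. *)
Lemma le_expectation_zero_set f g h : bounded_measurable f ->
  bounded_measurable g -> bounded_measurable h -> (forall x, 0 <= f x) ->
  E f <= 0 -> (forall x, f x = 0 -> g x <= h x) -> E g <= E h.
Proof.
move=> bf bg bh f0 Ef gh.
have bm := bounded_measurable_max bg bh.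
have -> : E h = E (fun x => Num.max (g x) (h x)).
  rewrite /Rintegral; congr fine; apply: ae_eq_integral => //.
  - exact/measurable_EFinP/bh.1.
  - exact/measurable_EFinP/bm.1.
  - have : ae_eq P setT (EFin \o f) (cst 0%E).
      apply/ae_eq_integral_abs => //; first exact/measurable_EFinP/bf.1.
      under eq_integral do rewrite /= ger0_norm//.
      rewrite EFin_expectation//; congr EFin; apply/eqP; rewrite eq_le Ef.
      by rewrite Rintegral_ge0.
    apply: filterS => x /(_ I) /= [fx] _.
    by congr EFin; rewrite max_r// gh.
by apply: le_expectation => // x; rewrite le_max lexx.
Qed.

Lemma bounded_cvg_expectation (f : nat -> T -> R) g c :
  (forall n, measurable_fun setT (f n)) -> bounded_measurable g ->
  (forall n x, `|f n x| <= c) -> (forall x, f n x @[n --> \oo] --> g x) ->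
  E (f n) @[n --> \oo] --> E g.
Proof.
move=> mf bg fc fg.
have bf n : bounded_measurable (f n) by split => //; exists c.
have [|||||_ _ +] := @dominated_convergence _ _ _ P setT measurableT
  (fun n x => (f n x)%:E) (fun x => (g x)%:E) (fun=> c%:E).
- by move=> n; exact/measurable_EFinP.
- exact/measurable_EFinP/bg.1.
- by apply: aeW => x _; apply: cvg_EFin; [exact: nearW|exact: fg].
- exact/bounded_measurable_integrable/bounded_measurable_cst.
- by apply: aeW => x n _; rewrite abse_EFin lee_fin.
rewrite EFin_expectation//; under eq_fun do rewrite EFin_expectation//.
by move/fine_cvgP => [].
Qed.

End bounded_expectation.

(** * Measurability on the Grassmannian *)

Section grassmannian_functions.
Variables (R : realType) (k : scalars) (m r : nat) (rm : (r <= m)%N).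
Local Notation F := (scalar_field R k).
Local Notation iota := (real_scalar R k).
Local Notation G := (grassmannian R k m r rm).
Local Notation GB := (grass_borel R k m r rm).

Lemma dim_grass (U : G) : \dim (grass_vspace U) = r.
Proof. by case: U => U /= /eqP. Qed.

Lemma basis_mxE (U : G) : mxrange (basis_mx U) = grass_vspace U.
Proof.
have dU := dim_grass U; have vU : size (vbasis U) = r by rewrite size_tuple.
have QE c : basis_mx U *m c = \sum_(j < r) c j 0 *: (vbasis U)`_j.
  apply/matrixP => i l; rewrite ord1 mxE summxE; apply: eq_bigr => j _.
  by rewrite !mxE mulrC.
apply/vspaceP => v; apply/mxrangeP/idP => [[c ->]|vU'].
  rewrite QE memv_suml// => j _; apply: memvZ; apply: vbasis_mem.
  by rewrite mem_nth// vU.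
exists (\col_j coord (vbasis U) (cast_ord (esym dU) j) v).
rewrite QE {1}(coord_vbasis vU') (reindex (cast_ord dU)) /=; last first.
  by exists (cast_ord (esym dU)) => j _; rewrite ?cast_ordK ?cast_ordKV.
by apply: eq_bigr => j _; rewrite mxE cast_ordK.
Qed.

Lemma rank_basis_mx (U : G) : \rank (basis_mx U) = r.
Proof. by rewrite -dim_mxrange basis_mxE dim_grass. Qed.

(** The quotient topology only sees matrices of rank [r], so [O] may be any open set of matrices
    that describes [A] on those. *)
Lemma grass_open_pred (O : set 'M[F]_(m, r)) (A : set G) : open O ->
  (forall U X, \rank X = r -> grass_vspace U = mxrange X -> A U <-> O X) ->
  open A.
Proof.
move=> oO AO; apply/open_subspaceP; exists O => //.
apply/seteqP; split => [X [OX]|X [[U AU UX]]] rX; split=> //.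
  have rX' : \dim (mxrange X) == r by apply/eqP.
  exists (Grassmannian rm rX') => //; apply/(AO _ X) => //.
  by rewrite -dim_mxrange.
by apply/(AO U X) => //; rewrite -dim_mxrange.
Qed.

Lemma open_grass_measurable (A : set G) : open A -> measurable (A : set GB).
Proof. by move=> oA; apply: sub_sigma_algebra. Qed.

(** Open sublevel sets cover the log-ratio as well as the dimension of an intersection, which jumps
    up in the limit. *)
Lemma usc_measurable (f : GB -> R) :
  (forall a, open ([set U | f U < a] : set G)) -> measurable_fun setT f.
Proof.
move=> of_; apply: (measurability _ (RGenInftyO.measurableE R)) => //.
move=> _ [_ [a ->] <-]; rewrite setTI; apply: open_grass_measurable.
rewrite (_ : _ @^-1` _ = [set U | f U < a]); first exact: of_.
by apply/seteqP; split => U /=; rewrite in_itv.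
Qed.

Definition gram_det (T : 'M[F]_m) (X : 'M[F]_(m, r)) : R :=
  re_scalar (\det (X^H *m T *m X)).

Lemma gram_detE T X : pdmx T -> \rank X = r ->
  iota (gram_det T X) = \det (X^H *m T *m X).
Proof.
move=> pT rX; rewrite /gram_det real_scalar_re// ge0_conj_scalar// ltW//.
exact/pd_det_gt0/pd_conj.
Qed.

Lemma gram_det_gt0 T X : pdmx T -> \rank X = r -> 0 < gram_det T X.
Proof.
move=> pT rX; rewrite -(ltr_real_scalar k) rmorph0 gram_detE//.
exact/pd_det_gt0/pd_conj.
Qed.

Lemma gram_detM T X (W : 'M[F]_r) : pdmx T -> \rank X = r -> \rank (X *m W) = r ->
  gram_det T (X *m W) = re_scalar (`|\det W| ^+ 2) * gram_det T X.
Proof.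
move=> pT rX rXW; rewrite /gram_det.
have -> : (X *m W)^H *m T *m (X *m W) = W^H *m (X^H *m T *m X) *m W.
  by rewrite adjmxM !mulmxA.
rewrite 2![\det (_ *m _)]det_mulmx det_adjmx mulrAC conj_scalarM -re_scalarM.
by rewrite real_scalar_re// -conj_scalarM rmorphM conj_scalarK mulrC.
Qed.

(** This is twice the loss of [U] at the parameter [invmx T]. *)
Definition log_ratio (T : 'M[F]_m) (U : G) : R :=
  ln (gram_det T (basis_mx U) / gram_det 1%:M (basis_mx U)).

(** A change of basis multiplies both determinants by the same factor. This frees topological
    arguments from the chosen basis of [U]. *)
Lemma log_ratioE T U X : pdmx T -> \rank X = r -> grass_vspace U = mxrange X ->
  log_ratio T U = ln (gram_det T X / gram_det 1%:M X).
Proof.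
move=> pT rX UX; have rU := rank_basis_mx U.
have /mxrange_sub[W XW] : (mxrange (basis_mx U) <= mxrange X)%VS.
  by rewrite basis_mxE UX subvv.
have p1 : pdmx (1%:M : 'M[F]_m) by exact: pd1.
rewrite /log_ratio XW !gram_detM// -?XW//; congr ln.
rewrite -mulf_div divff ?mul1r//.
have := gram_det_gt0 p1 rU; rewrite {1}XW gram_detM// -?XW//.
by move=> h; apply/eqP => w0; rewrite w0 mul0r ltxx in h.
Qed.

Lemma gram_det_continuous T : continuous (gram_det T : 'M[F]_(m, r) -> R).
Proof.
move=> X; apply: (@cvg_comp _ F R (fun X : 'M[F]_(m, r) => \det (X^H *m T *m X))
  (@re_scalar R k) (nbhs X) (nbhs (\det (X^H *m T *m X)))); last first.
  exact: re_scalar_continuous.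
have idX : mx_cvg (nbhs X) id X by move=> i j; exact: coord_continuous.
apply: cvg_det; apply: mx_cvgM => //; apply: mx_cvgM; last exact: mx_cvg_cst.
exact: mx_cvg_adj.
Qed.

Lemma measurable_log_ratio T : pdmx T ->
  measurable_fun setT (log_ratio T : GB -> R).
Proof.
move=> pT; apply: usc_measurable => a.
have p1 : pdmx (1%:M : 'M[F]_m) by exact: pd1.
(* Clearing the logarithm and the denominator gives a condition that is continuous on all matrices,
   including those of lower rank. *)
apply: (@grass_open_pred [set X | gram_det T X - expR a * gram_det 1%:M X < 0]).
  apply: (@open_comp _ _ (fun X => gram_det T X - expR a * gram_det 1%:M X)
    [set y | y < 0]); last exact: open_lt.
  move=> X _; have cT := @gram_det_continuous T X.
  have c1 := @gram_det_continuous 1%:M X.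
  exact: cvgB cT (cvgM (cvg_cst _) c1).
move=> U X rX UX /=; rewrite (log_ratioE pT rX UX) subr_lt0.
have q0 : 0 < gram_det T X / gram_det 1%:M X.
  by rewrite divr_gt0 ?gram_det_gt0.
by rewrite -{1}(expRK a) ltr_ln ?posrE ?expR_gt0// ltr_pdivrMr ?gram_det_gt0.
Qed.

Lemma dim_cap_open (V : {vspace 'cV[F]_m}) s :
  open [set U : G | (\dim (grass_vspace U :&: V) <= s)%N].
Proof.
have [Q rQ QV] := vspace_mxrange V; rewrite -QV; set p := \dim V in Q rQ QV *.
pose O (N : 'M[F]_(r + p - s, m) * 'M[F]_(r + p, r + p - s)) :=
  [set X : 'M[F]_(m, r) | \det (N.1 *m row_mx X Q *m N.2) != 0].
apply: (@grass_open_pred (\bigcup_N O N)).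
  apply: bigcup_open => N _.
  apply: (@open_comp _ _ (fun X : 'M[F]_(m, r) => \det (N.1 *m row_mx X Q *m N.2))
     [set y | y != 0]); last first.
    rewrite (_ : mkset _ = ~` [set 0]); last first.
      by apply/seteqP; split => y /= /eqP.
    apply: closed_openC; apply: accessible_closed_set1.
    exact/hausdorff_accessible/norm_hausdorff.
  move=> X _; have rowX : mx_cvg (nbhs X) (fun Y => row_mx Y Q) (row_mx X Q).
    move=> i j; rewrite !mxE; under eq_fun do rewrite mxE.
    by case: splitP => l _; [exact: coord_continuous|exact: cvg_cst].
  have c1 : mx_cvg (nbhs X) (fun=> N.1) N.1 by exact: mx_cvg_cst.
  have c2 : mx_cvg (nbhs X) (fun=> N.2) N.2 by exact: mx_cvg_cst.
  exact: cvg_det (mx_cvgM (mx_cvgM c1 rowX) c2).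
move=> U X rX UX; rewrite /= UX dim_cap_leP//; split.
  by move=> /rank_geP[N1 [N2 N12]]; exists (N1, N2).
by move=> [[N1 N2] _ /= N12]; apply/rank_geP; exists N1, N2.
Qed.

Lemma dim_cap_bounded_measurable (V : {vspace 'cV[F]_m}) :
  bounded_measurable (fun U : GB => (\dim (grass_vspace U :&: V))%:R : R).
Proof.
split; last first.
  exists r%:R => U; rewrite ger0_norm ?ler0n// ler_nat -{2}(dim_grass U).
  by rewrite dimvS// capvSl.
apply: usc_measurable => a.
rewrite (_ : [set U | _] = \bigcup_(s in [set s : nat | s%:R < a])
   [set U : G | (\dim (grass_vspace U :&: V) <= s)%N]).
  by apply: bigcup_open => s _; exact: dim_cap_open.
apply/seteqP; split => [U /= Ua|U [s /= sa Us]].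
  by exists (\dim (grass_vspace U :&: V)) => /=.
by apply: le_lt_trans sa; rewrite ler_nat.
Qed.

End grassmannian_functions.

(** * Mean log-ratio, necessity and uniqueness *)

Section likelihood.
Variables (R : realType) (k : scalars) (m r : nat) (rm : (r <= m)%N).
Hypothesis m_gt0 : (0 < m)%N.
Local Notation F := (scalar_field R k).
Local Notation iota := (real_scalar R k).
Local Notation G := (grassmannian R k m r rm).
Local Notation GB := (grass_borel R k m r rm).
Local Notation gram_det := (@gram_det R k m r).
Local Notation log_ratio := (@log_ratio R k m r rm).

Lemma gram_ratio_gt0 (T : 'M[F]_m) X : pdmx T -> \rank X = r ->
  0 < gram_det T X / gram_det 1%:M X.
Proof. by move=> pT rX; rewrite divr_gt0 ?gram_det_gt0//; exact: pd1. Qed.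

Lemma log_ratioB (T : 'M[F]_m) (U : G) : pdmx T ->
  log_ratio T U = ln (gram_det T (basis_mx U)) - ln (gram_det 1%:M (basis_mx U)).
Proof.
move=> pT; have rU := rank_basis_mx U; rewrite /log_ratio ln_div ?posrE ?gram_det_gt0//.
exact: pd1.
Qed.

Lemma log_ratioZ a (T : 'M[F]_m) (U : G) : pdmx T -> 0 < a ->
  log_ratio (iota a *: T) U = r%:R * ln a + log_ratio T U.
Proof.
move=> pT a0; have rU := rank_basis_mx U; rewrite !log_ratioB//; last exact: pdZ.
have -> : gram_det (iota a *: T) (basis_mx U) = a ^+ r * gram_det T (basis_mx U).
  by rewrite /gram_det -scalemxAr -scalemxAl detZ -rmorphXn re_scalarM.
by rewrite lnM ?posrE ?exprn_gt0 ?gram_det_gt0// lnXn// mulr_natl addrA.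
Qed.

(** With logarithmic coordinates [x] and [|\det A| = 1], determinant 1 means that the entries of [x]
    sum to 0. *)
Definition ldlmx (A : 'M[F]_m) (x : 'rV[R]_m) : 'M[F]_m :=
  A^H *m diag_mx (map_mx iota (map_mx expR x)) *m A.

Definition admissible (A : 'M[F]_m) := `|\det A| = 1 /\ forall i j, `|A i j| <= 1.

Lemma pd_ldlmx A x : `|\det A| = 1 -> pdmx (ldlmx A x).
Proof.
move=> dA; apply: pd_conj.
  by rewrite mxrank_unit// unitmxE unitfE -normr_eq0 dA oner_eq0.
by apply: pd_diag => i; rewrite mxE expR_gt0.
Qed.

Lemma det_ldlmx A x : `|\det A| = 1 -> \det (ldlmx A x) = iota (expR (\sum_i x 0 i)).
Proof.
move=> dA; rewrite det_ldl// expR_sum; congr (iota _).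
by apply: eq_bigr => i _; rewrite mxE.
Qed.

Lemma pd_ldlmx_exists T : pdmx T -> exists A x, admissible A /\ T = ldlmx A x.
Proof.
move=> /pivoted_ldl[A [d [-> d0 dA A1]]]; exists A, (map_mx (@ln R) d).
split => //; rewrite /ldlmx; congr (_ *m diag_mx (map_mx iota _) *m _).
by apply/rowP => i; rewrite !mxE lnK// posrE.
Qed.

(** The constant is uniform in [A] and the bound is affine in the size of [x]. After division by
    that size it provides the constant for dominated convergence. *)
Lemma log_ratio_ldlmx_bound : exists2 c : R, 0 <= c &
  forall A (x : 'rV[R]_m) M, admissible A -> (forall i, `|x 0 i| <= M) ->
  forall U, `|log_ratio (ldlmx A x) U| <= r%:R * (M + c).
Proof.
have [[c1 c2] [/= c1_gt0 c2_gt0] cA] := gram_bounds R k m.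
exists (`|ln c1| + `|ln c2|); first by rewrite addr_ge0.
move=> A x M aA xM U; have rU := rank_basis_mx U.
have [dA A1] := aA; have [Ac1 Ac2] := cA A dA A1.
have [lo hi] : psdmx (ldlmx A x - iota (expR (- M)) *: (A^H *m A)) /\
    psdmx (iota (expR M) *: (A^H *m A) - ldlmx A x).
  by apply: ldl_bounds => i; rewrite mxE ler_expR; have := xM i; rewrite ler_norml => /andP[].
have {}lo : psdmx (ldlmx A x - iota (expR (- M) * c1) *: 1%:M).
  rewrite rmorphM -scalerA -(subrK (iota (expR (- M)) *: (A^H *m A)) (ldlmx A x)).
  by rewrite -addrA -scalerBr; apply: psdD => //; apply: psdZ => //; exact: expR_ge0.
have {}hi : psdmx (iota (expR M * c2) *: 1%:M - ldlmx A x).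
  rewrite rmorphM -scalerA -(subrK (iota (expR M) *: (A^H *m A)) (_ *: (_ *: _))).
  by rewrite -addrA -scalerBr; apply: psdD => //; apply: psdZ => //; exact: expR_ge0.
have pT := pd_ldlmx x dA; have p1 : pdmx (1%:M : 'M[F]_m) by exact: pd1.
have a0 : 0 < expR (- M) * c1 by rewrite mulr_gt0 ?expR_gt0.
have b0 : 0 < expR M * c2 by rewrite mulr_gt0 ?expR_gt0.
have := gram_det_bounds rU a0 lo hi.
have e1 : \det ((basis_mx U)^H *m basis_mx U) = iota (gram_det 1%:M (basis_mx U)).
  by rewrite gram_detE// mulmx1.
rewrite e1 -(gram_detE pT rU) -!rmorphM !ler_real_scalar.
have g1 := gram_det_gt0 p1 rU; have gT := gram_det_gt0 pT rU.
rewrite -ler_pdivlMr// -[X in _ && X]ler_pdivrMr// => /andP[L1 L2].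
have q0 := gram_ratio_gt0 pT rU.
rewrite ler_norml; apply/andP; split.
  move: L1; rewrite -ler_ln ?posrE ?exprn_gt0// lnXn// lnM ?posrE ?expR_gt0// expRK.
  apply: le_trans; rewrite -mulrN -[X in _ <= X]mulr_natl ler_wpM2l ?ler0n//.
  have := ler_norm (- ln c1); have := normr_ge0 (ln c2); rewrite normrN; lra.
move: L2; rewrite -ler_ln ?posrE ?exprn_gt0// lnXn// lnM ?posrE ?expR_gt0// expRK.
move=> /le_trans; apply; rewrite -[X in X <= _]mulr_natl ler_wpM2l ?ler0n//.
have := ler_norm (ln c2); have := normr_ge0 (ln c1); lra.
Qed.

Lemma log_ratio_bounded_measurable T : pdmx T ->
  bounded_measurable (log_ratio T : GB -> R).
Proof.
move=> pT; split; first exact: measurable_log_ratio.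
have [A [x [aA ->]]] := pd_ldlmx_exists pT.
have [c c0 cb] := log_ratio_ldlmx_bound.
exists (r%:R * (\sum_i `|x 0 i| + c)) => U; apply: cb => // i.
by rewrite (bigD1 i)//= lerDl sumr_ge0.
Qed.

Variable P : probability GB R.

Definition mean_log_ratio (T : 'M[F]_m) := \int[P]_U log_ratio T U.

Local Notation L := mean_log_ratio.

Lemma mean_log_ratioZ a T : pdmx T -> 0 < a -> L (iota a *: T) = r%:R * ln a + L T.
Proof.
move=> pT a0; rewrite /L; under eq_Rintegral do rewrite log_ratioZ//.
rewrite expectationD ?expectation_cst//; first exact: bounded_measurable_cst.
exact: log_ratio_bounded_measurable.
Qed.

Lemma PosE (T : 'M[F]_m) : Pos T <-> pdmx T /\ \det T = 1.
Proof. by split=> [[]|[[]]]. Qed.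

Lemma Pos_inv (T : 'M[F]_m) : Pos T -> Pos (invmx T).
Proof.
move=> /PosE[pT dT]; apply/PosE; split; first exact: pd_inv.
by rewrite det_inv dT invr1.
Qed.

(* Here [T] stands for the inverse of the parameter of the distribution. *)
Definition mean_minimizer T := Pos T /\ forall T', Pos T' -> L T <= L T'.

Lemma log_likelihoodE S : Pos S ->
  log_likelihood P S = (- ((real_dim k * m)%:R / 2 * L (invmx S)))%:E.
Proof.
move=> /PosE[pS dS]; have pV := pd_inv pS.
rewrite /log_likelihood -mulNr /L -expectationZ; last exact: log_ratio_bounded_measurable.
rewrite -EFin_expectation; last exact/bounded_measurableZ/log_ratio_bounded_measurable.
apply: eq_integral => U _; congr EFin; rewrite /grass_density ln_powR mulNr -mulrN.
congr (_ * _); rewrite log_ratioB// opprB; have rU := rank_basis_mx U.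
have := gram_det_gt0 pV rU; have := gram_det_gt0 (@pd1 R k m) rU.
by rewrite /gram_det mulmx1 => h1 h2; rewrite ln_div.
Qed.

Lemma is_GE_minimizer S : is_GE P S <-> mean_minimizer (invmx S).
Proof.
have c0 : 0 < (real_dim k * m)%:R / 2 :> R.
  by rewrite divr_gt0// ltr0n muln_gt0 m_gt0 andbT; case: (k).
split=> [[pS minS]|[/Pos_inv pS minS]].
  split; first exact: Pos_inv.
  move=> T pT; have pV := Pos_inv pT; move: (minS _ pV).
  rewrite (log_likelihoodE pS) (log_likelihoodE pV) invmxK.
  by rewrite lee_fin lerN2 (ler_pM2l c0).
rewrite invmxK in pS; split; first exact: pS.
move=> T pT.
rewrite (log_likelihoodE pS) (log_likelihoodE pT) lee_fin lerN2 (ler_pM2l c0).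
exact/minS/Pos_inv.
Qed.

Definition normalize (T : 'M[F]_m) : 'M[F]_m :=
  iota (expR (- ln (re_scalar (\det T)) / m%:R)) *: T.

Lemma re_det_gt0 (T : 'M[F]_m) : pdmx T -> 0 < re_scalar (\det T).
Proof.
move=> pT; rewrite -(ltr_real_scalar k) rmorph0 real_scalar_re ?pd_det_gt0//.
exact/ge0_conj_scalar/ltW/pd_det_gt0.
Qed.

Lemma Pos_normalize T : pdmx T -> Pos (normalize T).
Proof.
move=> pT; apply/PosE; split; first by apply: pdZ => //; exact: expR_gt0.
rewrite detZ -rmorphXn -expRM_natr divfK ?pnatr_eq0 -?lt0n//.
rewrite expRN lnK ?posrE ?re_det_gt0// -{2}[\det T]real_scalar_re; last first.
  exact/ge0_conj_scalar/ltW/pd_det_gt0.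
by rewrite -rmorphM mulVf ?rmorph1// lt0r_neq0// re_det_gt0.
Qed.

(** The threshold [r / m] originates here: the factor restoring determinant 1 is an [m]-th root and
    enters the [r] by [r] determinant with exponent [r]. *)
Lemma mean_log_ratio_normalize T : pdmx T ->
  L (normalize T) = L T - r%:R / m%:R * ln (re_scalar (\det T)).
Proof.
move=> pT; rewrite mean_log_ratioZ ?expR_gt0// expRK addrC; congr (_ + _).
by rewrite mulNr mulrN mulrCA mulrC.
Qed.

Lemma mean_minimizer_unique_strict T V : (r < m)%N -> mean_minimizer T ->
  (forall T', mean_minimizer T' -> T' = T) -> V != 0%VS -> V != fullv ->
  \int[P]_U (\dim (grass_vspace U :&: V))%:R < r%:R / m%:R * (\dim V)%:R :> R.
Proof.
move=> lt_rm [posT minT] uniqT V0 VF; rewrite ltNge; apply/negP => le_rV.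
have [pT dT] := (PosE T).1 posT.
have [Q rQ QV] := vspace_mxrange V.
have v_lt : (\dim V < m)%N.
  rewrite -[X in (_ < X)%N](dim_colvec R k) ltnNge; apply: contra VF => le.
  by rewrite eqEdim subvf.
have v_gt0 : (0 < \dim V)%N by rewrite lt0n dimv_eq0.
pose q : R := 2^-1; have q0 : 0 < q by rewrite invr_gt0.
have q1 : q <= 1 by rewrite invf_le1// ler1n.
have lq : ln q < 0 by rewrite ln_lt0// q0 invf_lt1// ltr1n.
have pS := pd_shrink pT rQ q0 q1; have dS := det_shrink q pT rQ.
rewrite dT mulr1 in dS; set S := shrink T Q q in pS dS.
have bd := dim_cap_bounded_measurable rm V.
have LS : L S <= ln q * (\int[P]_U (\dim (grass_vspace U :&: V))%:R) + L T.
  rewrite /L -expectationZ// -expectationD; last 2 first.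
  - exact: bounded_measurableZ.
  - exact: log_ratio_bounded_measurable.
  apply: le_expectation.
  - exact: log_ratio_bounded_measurable.
  - by apply: bounded_measurableD; [exact: bounded_measurableZ|exact: log_ratio_bounded_measurable].
  move=> U; have rU := rank_basis_mx U.
  have [a [b [ab ra rb]]] := mxrange_cap (basis_mx U) Q.
  have := det_shrink_le pT rU rQ q0 q1 ab ra rb.
  rewrite -/S -!gram_detE// -rmorphM ler_real_scalar basis_mxE QV => le.
  rewrite !log_ratioB// addrA lerD2r.
  have gT := gram_det_gt0 pT rU.
  rewrite -ler_ln ?posrE ?mulr_gt0 ?exprn_gt0 ?gram_det_gt0// in le.
  by apply: le_trans le _; rewrite lnM ?posrE ?exprn_gt0// lnXn// mulr_natr.
have ST : normalize S = T.
  apply: uniqT; split; first exact: Pos_normalize.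
  move=> T' posT'; apply: le_trans (minT _ posT').
  rewrite mean_log_ratio_normalize// dS re_real_scalar lnXn//.
  rewrite -[ln q *+ _]mulr_natr lerBlDr (le_trans LS)// addrC lerD2l mulrCA.
  exact: ler_wnM2l (ltW lq) _ _ le_rV.
move: ST; rewrite /normalize; set a := expR _ => ST.
have a0 : 0 < a by exact: expR_gt0.
have SQ : S *m Q = iota q *: (T *m Q).
  rewrite /S /shrink mulmxBl -scalemxAl -!mulmxA mulVmx ?pd_unit//; last first.
    by rewrite mulmxA; exact: pd_conj.
  by rewrite mulmx1 -{1}[T *m Q]scale1r -scalerBl rmorphB rmorph1 opprB addrC subrK.
(* If the new minimizer were [T] itself, then comparing the two on [V], where [S] acts as [q] times
   [T], would give this. The determinants then yield [a ^+ (m - \dim V) = 1], so [a = 1] and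
   [q = 1], against [ln q < 0]. *)
have aq : a * q = 1.
  have TQ0 : T *m Q != 0.
    apply/eqP => TQ0; move: v_gt0; rewrite -rQ -(mulKmx (pd_unit pT) Q) TQ0 mulmx0.
    by rewrite mxrank0.
  have : iota (a * q - 1) *: (T *m Q) = 0.
    by rewrite rmorphB rmorph1 scalerBl scale1r rmorphM -scalerA -SQ scalemxAl ST subrr.
  by move/eqP; rewrite scaler_eq0 (negbTE TQ0) orbF fmorph_eq0 subr_eq0 => /eqP.
have : \det (iota a *: S) = 1 by rewrite ST.
rewrite detZ dS -rmorphXn -rmorphM -(rmorph1 iota) => /(fmorph_inj iota)/eqP.
have -> : a ^+ m = a ^+ (m - \dim V) * a ^+ \dim V.
  by rewrite -exprD subnK// ltnW.
rewrite -mulrA -exprMn aq expr1n mulr1.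
rewrite pexpr_eq1 ?subn_gt0 ?(ltW a0)// => /eqP a1.
by move: aq lq; rewrite a1 mul1r => ->; rewrite ln1 ltxx.
Qed.

Lemma mean_minimizer_unique A B :
  (forall V : {vspace 'cV[F]_m}, V != 0%VS -> V != fullv ->
    \int[P]_U (\dim (grass_vspace U :&: V))%:R < r%:R / m%:R * (\dim V)%:R :> R) ->
  mean_minimizer A -> mean_minimizer B -> A = B.
Proof.
move=> HV [posA minA] [posB minB]; apply/eqP/negPn/negP => AB.
have [pA dA] := (PosE A).1 posA; have [pB dB] := (PosE B).1 posB.
have [E [W [[E0 EF] [W0 WF] EW invEW]]] := kernel_range_split m_gt0 pA pB dA dB AB.
have pM : pdmx (A + B) by apply/pdD/pd_psd.
have pH := pd_parallel_sum pA pB; set M := A + B in pM; set H := parallel_sum A B in pH.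
have bA := log_ratio_bounded_measurable pA; have bB := log_ratio_bounded_measurable pB.
have bM := log_ratio_bounded_measurable pM; have bH := log_ratio_bounded_measurable pH.
pose f (U : GB) := log_ratio A U + log_ratio B U + -1 * (log_ratio M U + log_ratio H U).
have bf : bounded_measurable f.
  by do 2?apply: bounded_measurableD => //; apply/bounded_measurableZ/bounded_measurableD.
have detMH : re_scalar (\det M) * re_scalar (\det H) = 1.
  have := det_parallel_sum pA pB; rewrite dA dB mulr1 -/M -/H.
  rewrite -[\det M]real_scalar_re ?ge0_conj_scalar ?ltW ?pd_det_gt0//.
  rewrite -[\det H]real_scalar_re ?ge0_conj_scalar ?ltW ?pd_det_gt0//.
  rewrite -rmorphM -(rmorph1 iota) => /(fmorph_inj iota).
  by rewrite !re_real_scalar mulrC.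
(* Normalizing [M] and [H] changes the sum of their means by a multiple of the logarithm of
   [\det M * \det H], which is 0. Minimality of [A] and [B] thus applies to the sum directly. *)
have Ef : \int[P]_U f U <= 0.
  have -> : \int[P]_U f U = L A + L B + -1 * (L M + L H).
    rewrite expectationD ?expectationZ ?expectationD//.
    - exact: bounded_measurableD.
    - exact: bounded_measurableD.
    - exact/bounded_measurableZ/bounded_measurableD.
  have := minA _ (Pos_normalize pM); have := minB _ (Pos_normalize pH).
  rewrite !mean_log_ratio_normalize//.
  have : ln (re_scalar (\det M)) + ln (re_scalar (\det H)) = 0.
    by rewrite -lnM ?posrE ?re_det_gt0// detMH ln1.
  move: (L A) (L B) (L M) (L H) (r%:R / m%:R) (ln _) (ln _).
  move=> a b c d rho x y xy h1 h2; have e : rho * x + rho * y = 0.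
    by rewrite -mulrDr addrC xy mulr0.
  lra.
have gp (T : 'M[F]_m) U : pdmx T -> 0 < gram_det T (basis_mx U).
  by move=> pT; rewrite gram_det_gt0// rank_basis_mx.
have fE (U : G) : f U = ln (gram_det A (basis_mx U) * gram_det B (basis_mx U)) -
    ln (gram_det H (basis_mx U) * gram_det M (basis_mx U)).
  rewrite /f !log_ratioB// !lnM ?posrE ?gp//; ring.
have detU (U : G) := det_parallel_sum_le pA pB (rank_basis_mx U).
have f0 U : 0 <= f U.
  have [+ _] := detU U; rewrite fE subr_ge0 -/M -/H -!gram_detE ?rank_basis_mx//.
  by rewrite -!rmorphM ler_real_scalar ler_ln ?posrE ?mulr_gt0 ?gp.
have bE := dim_cap_bounded_measurable rm E; have bW := dim_cap_bounded_measurable rm W.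
have := @le_expectation_zero_set _ _ _ P f (fun=> r%:R)
  (fun U => (\dim (grass_vspace U :&: E))%:R + (\dim (grass_vspace U :&: W))%:R)
  bf (bounded_measurable_cst _ _) (bounded_measurableD bE bW) f0 Ef.
rewrite expectation_cst expectationD// => le_r.
suff /le_r : forall U : GB, f U = 0 ->
    r%:R <= (\dim (grass_vspace U :&: E))%:R + (\dim (grass_vspace U :&: W))%:R :> R.
  have := HV _ E0 EF; have := HV _ W0 WF.
  move: (\int[P]_U _) (\int[P]_U _) => a b.
  have : r%:R / m%:R * (\dim E)%:R + r%:R / m%:R * (\dim W)%:R = r%:R :> R.
    by rewrite -mulrDr -natrD EW divfK// pnatr_eq0 -lt0n.
  move=> e hb ha le; have := ltrD ha hb; rewrite e => h.
  by have := le_lt_trans le h; rewrite ltxx.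
move=> U /eqP; rewrite fE subr_eq0 => /eqP/ln_inj.
rewrite !posrE !mulr_gt0 ?gp// => /(_ isT isT) e.
have [_ ] := detU U; rewrite -/M -/H -!gram_detE ?rank_basis_mx//.
rewrite -!rmorphM e => /(_ erefl)[Y XY].
by have := invEW _ _ _ XY; rewrite basis_mxE dim_grass -natrD ler_nat.
Qed.

End likelihood.

(** * Compactness and summation by parts *)

Section subsequences.
Variable R : realType.

Lemma cvg_infty_ge (f : nat -> nat) : (forall n, (n <= f n)%N) ->
  f n @[n --> \oo] --> \oo.
Proof.
move=> fn A [N _ NA]; exists N => // n /= Nn.
by apply: NA; exact: leq_trans Nn (fn n).
Qed.

(** Bolzano-Weierstrass is applied to one index of [s] after the other. The condition [n <= f n] is
    stable under composition and ensures that the limits survive. *)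
Lemma bounded_family_subsequence (I : eqType) (s : seq I) (u : I -> nat -> R) c :
  (forall i n, `|u i n| <= c) ->
  exists2 f : nat -> nat, (forall n, (n <= f n)%N) &
    forall i, i \in s -> cvgn (u i \o f).
Proof.
move=> uc; elim: s => [|i s [f fn cf]]; first by exists id.
have [|g gincr cg] := @bolzano_weierstrass R (u i \o f).
  by exists c; split; [exact: num_real|move=> y cy n _ /=; exact: le_trans (uc _ _) (ltW cy)].
have gn n : (n <= g n)%N.
  elim: n => // n IH; apply: leq_ltn_trans IH _.
  by move/increasing_seqP : gincr; exact.
exists (f \o g) => [n|j]; first exact: leq_trans (gn n) (fn _).
rewrite inE => /predU1P[->//|js].
by apply: cvgP; exact: cvg_comp (cvg_infty_ge gn) (cf j js).
Qed.

Definition im_scalar k : scalar_field R k -> R :=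
  match k return scalar_field R k -> R with
  | Reals => fun=> 0
  | Complexes => @complex.Im R
  end.

(** The value 0 in the real case is harmless, because [im_scalar] vanishes there as well. *)
Definition imaginary_unit k : scalar_field R k :=
  match k with Reals => 0 | Complexes => 'i%C end.

Lemma scalar_re_im k (x : scalar_field R k) :
  x = real_scalar R k (re_scalar x) + imaginary_unit k * real_scalar R k (im_scalar x).
Proof.
case: k x => [x|[a b]] /=; first by rewrite mul0r addr0.
by apply/eqP; rewrite eq_complex /= !(mul0r, mul1r, mulr0, subr0, addr0, add0r) !eqxx.
Qed.

Lemma im_scalar_le_norm k (x : scalar_field R k) :
  real_scalar R k `|im_scalar x| <= `|x|.
Proof.
case: k x => [x|[a b]] /=; first by rewrite normr0.
rewrite normc_def /= lecR -sqrtr_sqr ler_wsqrtr// lerDr sqr_ge0//.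
Qed.

Lemma scalar_family_subsequence k (I J : finType) (A : nat -> I -> scalar_field R k)
    (y : nat -> J -> R) (c : R) :
  (forall n i, `|A n i| <= real_scalar R k c) -> (forall n j, `|y n j| <= c) ->
  exists f : nat -> nat, exists B : I -> scalar_field R k, exists z : J -> R,
  [/\ forall n, (n <= f n)%N, forall i, A (f n) i @[n --> \oo] --> B i &
      forall j, y (f n) j @[n --> \oo] --> z j].
Proof.
move=> Ac yc.
pose u (i : I * bool + J) n := match i with
  | inl (i, true) => re_scalar (A n i) | inl (i, false) => im_scalar (A n i)
  | inr j => y n j end.
have uc i n : `|u i n| <= c.
  case: i => [[i []]|j] /=; last exact: yc.
    rewrite -(ler_real_scalar k); exact: le_trans (re_scalar_le_norm _) (Ac n i).
  rewrite -(ler_real_scalar k); exact: le_trans (im_scalar_le_norm _) (Ac n i).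
have [f fn cf] := bounded_family_subsequence (enum {: (I * bool + J)%type}) uc.
exists f, (fun i => real_scalar R k (limn (u (inl (i, true)) \o f)) +
  imaginary_unit k * real_scalar R k (limn (u (inl (i, false)) \o f))),
  (fun j => limn (u (inr j) \o f)); split => //.
- move=> i; rewrite [X in X @ _](_ : _ = fun n =>
    real_scalar R k ((u (inl (i, true)) \o f) n) +
    imaginary_unit k * real_scalar R k ((u (inl (i, false)) \o f) n)); last first.
    by apply/funext => n /=; exact: scalar_re_im.
  have cr b : real_scalar R k ((u (inl (i, b)) \o f) n) @[n --> \oo] -->
      real_scalar R k (limn (u (inl (i, b)) \o f)).
    have := cf (inl (i, b)); rewrite mem_enum => /(_ isT) c1.
    exact: cvg_comp c1 (@real_scalar_continuous R k _).
  exact: cvgD (cr true) (cvgM (cvg_cst _) (cr false)).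
- by move=> j; apply: (cf (inr j)); rewrite mem_enum.
Qed.

End subsequences.

Section abel.
Variable R : realType.

(** Indices in [nat] make the gaps between consecutive entries easy to write; the default 0 is only
    taken out of range. *)
Definition row_nth m (d : 'rV[R]_m) (j : nat) : R :=
  oapp (fun i => d 0 i) 0 (insub j : option 'I_m).

Lemma row_nthE m (d : 'rV[R]_m) (i : 'I_m) : row_nth d i = d 0 i.
Proof. by rewrite /row_nth valK. Qed.

(** Each entry is the first one plus the gaps up to its index. Exchanging the sums counts how often
    each of the [m.-1] gaps occurs. *)
Lemma abel_row m (I : finType) (d : 'rV[R]_m) (f : I -> 'I_m) :
  \sum_i d 0 (f i) = #|I|%:R * row_nth d 0 +
  \sum_(j < m.-1) (row_nth d j.+1 - row_nth d j) * #|[pred i | (j.+1 <= f i)%N]|%:R.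
Proof.
have E i : d 0 (f i) = row_nth d 0 +
    \sum_(j < m.-1) (row_nth d j.+1 - row_nth d j) * (j.+1 <= f i)%N%:R.
  have lt : (f i <= m.-1)%N by rewrite -ltnS (leq_trans (ltn_ord _))// leqSpred.
  rewrite -row_nthE -[LHS](subrK (row_nth d 0)) addrC; congr (_ + _).
  rewrite -(telescope_sumr (row_nth d) (leq0n _)) big_mkord.
  rewrite (big_ord_widen _ (fun j => row_nth d j.+1 - row_nth d j) lt) big_mkcond /=.
  by apply: eq_bigr => j _; case: ltnP => _; rewrite ?mulr1 ?mulr0.
under eq_bigr do rewrite E.
rewrite big_split /= sumr_const mulr_natl exchange_big /=; congr (_ + _).
apply: eq_bigr => j _; rewrite -mulr_sumr -natr_sum; congr (_ * _%:R).
by rewrite -big_mkcond sum1_card.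
Qed.

Lemma card_ord_ge m j : #|[pred i : 'I_m | (j <= i)%N]| = (m - j)%N.
Proof.
rewrite -sum1_card (eq_bigl (fun i : 'I_m => true && (j <= i)%N)) => [|i]; last by rewrite inE.
by rewrite -(big_geq_mkord j m xpredT (fun=> 1%N)) sum_nat_const_nat muln1.
Qed.

Lemma sorting_perm m (d : 'rV[R]_m) : exists s : 'S_m,
  forall i j : 'I_m, (i <= j)%N -> d 0 (s i) <= d 0 (s j).
Proof.
pose le (i j : 'I_m) := d 0 i <= d 0 j.
pose t := sort le (enum 'I_m).
have st : size t = m by rewrite size_sort size_enum_ord.
have ut : uniq t by rewrite sort_uniq enum_uniq.
have inj : injective (fun i : 'I_m => nth i t i).
  move=> i j; rewrite (set_nth_default j) ?st// => /eqP.
  by rewrite nth_uniq ?st// => /eqP/val_inj.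
exists (perm inj) => i j ij; rewrite !permE (set_nth_default j) ?st//.
have srt : sorted le t by apply: sort_sorted => ? ?; exact: le_total.
have le_tr : transitive le by move=> ? ? ?; exact: le_trans.
have le_refl : reflexive le by move=> ?; exact: lexx.
by apply: (sorted_leq_nth le_tr le_refl j srt); rewrite ?inE ?st.
Qed.

End abel.

(** * Coercivity and existence *)

Section coercivity.
Variables (R : realType) (k : scalars) (m r : nat) (rm : (r <= m)%N).
Hypothesis m_gt0 : (0 < m)%N.
Local Notation F := (scalar_field R k).
Local Notation iota := (real_scalar R k).
Local Notation G := (grassmannian R k m r rm).
Local Notation GB := (grass_borel R k m r rm).
Local Notation gram_det := (@gram_det R k m r).
Local Notation log_ratio := (@log_ratio R k m r rm).
Implicit Types (A : 'M[F]_m) (x d : 'rV[R]_m).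

(** This is the preimage under [A] of the span of the first [j] coordinate vectors; on it the form
    of [ldlmx A x] only involves the first [j] entries of [x]. *)
Definition flag A (j : nat) : {vspace 'cV[F]_m} :=
  lker (linfun (mulmx (lower_rows j A))).

Lemma lower_rowsM n j A (X : 'M[F]_(m, n)) :
  lower_rows j (A *m X) = lower_rows j A *m X.
Proof.
apply/matrixP => i l; rewrite !mxE; case: ifP => ji; first last.
  by rewrite big1// => a _; rewrite mxE ji mul0r.
by apply: eq_bigr => a _; rewrite mxE ji.
Qed.

Lemma rank_lower_rows A (U : G) j :
  \rank (lower_rows j (A *m basis_mx U)) =
  (r - \dim (grass_vspace U :&: flag A j))%N.
Proof.
have := limg_ker_dim (linfun (mulmx (lower_rows j A)) : 'End('cV[F]_m)) U.
rewrite -/(flag A j) -{2}basis_mxE mxrange_mul dim_mxrange dim_grass lower_rowsM => e.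
by rewrite -[LHS](addKn (\dim (grass_vspace U :&: flag A j))) e.
Qed.

Lemma dim_flag A j : A \in unitmx -> (j <= m)%N -> \dim (flag A j) = j.
Proof.
move=> uA jm; have := limg_ker_dim (linfun (mulmx (lower_rows j A)) : 'End('cV[F]_m)) fullv.
rewrite capfv dim_colvec.
have -> : \dim (limg (linfun (mulmx (lower_rows j A)) : 'End('cV[F]_m))) = (m - j)%N.
  rewrite -[limg _]/(mxrange (lower_rows j A)) dim_mxrange.
  rewrite -[A]mul1mx lower_rowsM mxrankMfree ?row_free_unit//.
  rewrite -(rank_copid_mx F jm); congr mxrank; apply/matrixP => i l.
  by rewrite !mxE; case: leqP => ji; rewrite ?andbF ?andbT ?subr0// subrr.
by move=> e; apply/eqP; rewrite -(eqn_add2r (m - j)) e subnKC.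
Qed.

(* A lower bound of the growth rate of [log_ratio (ldlmx A (t *: d)) U] as [t]
   goes to infinity. *)
Definition slope d A (U : G) : R :=
  r%:R * row_nth d 0 + \sum_(j < m.-1) (row_nth d j.+1 - row_nth d j) *
    (r%:R + -1 * (\dim (grass_vspace U :&: flag A j.+1))%:R).

Definition row_sorted d := forall i j : 'I_m, (i <= j)%N -> d 0 i <= d 0 j.

Lemma row_sorted_gap d (j : 'I_m.-1) : row_sorted d ->
  0 <= row_nth d j.+1 - row_nth d j.
Proof.
move=> sd; have j1m : (j.+1 < m)%N by rewrite -ltn_predRL.
have jm : (j < m)%N by exact: ltnW.
rewrite subr_ge0 -[j.+1]/(nat_of_ord (Ordinal j1m)) -[nat_of_ord j]/(nat_of_ord (Ordinal jm)).
by rewrite !row_nthE; apply: sd => /=.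
Qed.

(** In ascending order the gaps are nonnegative and the largest entries belong to the bottom rows.
    Pivot rows chosen from the bottom meet each trailing block at least as often as its rank, which
    is [r] minus the dimension of the intersection with the flag. *)
Lemma slope_le d A U : A \in unitmx -> row_sorted d ->
  exists f : 'I_r -> 'I_m, [/\ injective f,
    \det (rowsub f (A *m basis_mx U)) != 0 & slope d A U <= \sum_i d 0 (f i)].
Proof.
move=> uA sd; have rY : \rank (A *m basis_mx U) = r.
  by rewrite (eqmxMfull _ _) ?row_full_unit ?rank_basis_mx.
have [f [fi f0 fr]] := pivot_rows rY; exists f; split => //.
rewrite abel_row card_ord lerD2l; apply: ler_sum => j _.
rewrite ler_wpM2l ?row_sorted_gap//; apply: le_trans (_ : (r - \dim (grass_vspace U :&: flag A j.+1))%:R <= _).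
  rewrite natrB ?mulN1r// -[X in (_ <= X)%N](dim_grass U); exact/dimvS/capvSl.
by rewrite ler_nat -rank_lower_rows.
Qed.

Lemma slope_bounded_measurable d A : bounded_measurable (slope d A : GB -> R).
Proof.
apply: bounded_measurableD; first exact: bounded_measurable_cst.
apply: bounded_measurable_sum => j; apply: bounded_measurableZ.
apply: bounded_measurableD; first exact: bounded_measurable_cst.
exact/bounded_measurableZ/dim_cap_bounded_measurable.
Qed.

Lemma ldlmxE A x i j :
  ldlmx A x i j = \sum_l conj_scalar R k (A l i) * iota (expR (x 0 l)) * A l j.
Proof.
by rewrite /ldlmx mxE; apply: eq_bigr => l _; rewrite mul_mx_diag !mxE.
Qed.

Lemma ldlmx_perm (s : 'S_m) A x : ldlmx (row_perm s A) (col_perm s x) = ldlmx A x.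
Proof.
apply/matrixP => i j; rewrite !ldlmxE [RHS](reindex_inj (@perm_inj _ s)) /=.
by apply: eq_bigr => l _; rewrite !mxE.
Qed.

Lemma admissible_perm (s : 'S_m) A : admissible A -> admissible (row_perm s A).
Proof.
move=> [dA A1]; split; last by move=> i j; rewrite mxE.
rewrite row_permE det_mulmx normrM dA mulr1 det_perm normrX normrN normr1.
by rewrite expr1n.
Qed.

(** One Cauchy-Binet term bounds the log-ratio from below. Its minor has a nonzero limit, so the
    logarithm of its squared modulus stays bounded and disappears after division by [Mn n]; only the
    exponents remain. The minimum with [b] makes this lower bound a limit. *)
Lemma growth_rate (An : nat -> 'M[F]_m) (xn : nat -> 'rV[R]_m) (Mn : nat -> R) A d U
    (f : 'I_r -> 'I_m) b :
  (forall n, admissible (An n)) -> (forall n, 0 < Mn n) ->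
  (Mn n)^-1 @[n --> \oo] --> 0 -> mx_cvg \oo An A ->
  (forall i, (Mn n)^-1 * xn n 0 i @[n --> \oo] --> d 0 i) ->
  injective f -> \det (rowsub f (A *m basis_mx U)) != 0 -> b <= \sum_i d 0 (f i) ->
  Num.min ((Mn n)^-1 * log_ratio (ldlmx (An n) (xn n)) U) b @[n --> \oo] --> b.
Proof.
move=> aAn Mn0 Mn_oo AnA xnd fi fdet bd; set X := basis_mx U in fdet *.
have rX : \rank X = r := rank_basis_mx U.
pose w n : R := re_scalar (conj_scalar R k (\det (rowsub f (An n *m X))) *
  \det (rowsub f (An n *m X))).
pose w0 : R := re_scalar (conj_scalar R k (\det (rowsub f (A *m X))) *
  \det (rowsub f (A *m X))).
have dcvg : \det (rowsub f (An n *m X)) @[n --> \oo] --> \det (rowsub f (A *m X)).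
  apply: cvg_det; apply: mx_cvg_rowsub; apply: mx_cvgM => //.
  exact: mx_cvg_cst.
have wcvg : w n @[n --> \oo] --> w0.
  have c1 : conj_scalar R k (\det (rowsub f (An n *m X))) @[n --> \oo] -->
      conj_scalar R k (\det (rowsub f (A *m X))).
    exact: cvg_comp dcvg (@conj_scalar_continuous R k _).
  exact: cvg_comp (cvgM c1 dcvg) (@re_scalar_continuous R k _).
have w0_gt0 : 0 < w0.
  rewrite -(ltr_real_scalar k) rmorph0 real_scalar_re.
    by rewrite conj_scalarM exprn_gt0// normr_gt0.
  by rewrite rmorphM conj_scalarK mulrC.
have lnw : ln (w n) @[n --> \oo] --> ln w0.
  exact: cvg_comp wcvg (@continuous_ln R _ w0_gt0).
pose l n := \sum_i (Mn n)^-1 * xn n 0 (f i) +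
  (Mn n)^-1 * (ln (w n) - ln (gram_det 1%:M X)).
have lcvg : l n @[n --> \oo] --> \sum_i d 0 (f i).
  have c1 : \sum_i (Mn n)^-1 * xn n 0 (f i) @[n --> \oo] --> \sum_i d 0 (f i).
    by apply: cvg_big => [|i _]; [exact: add_continuous|exact: xnd].
  have c2 : (Mn n)^-1 * (ln (w n) - ln (gram_det 1%:M X)) @[n --> \oo] -->
      0 * (ln w0 - ln (gram_det 1%:M X)).
    by apply: cvgM => //; apply: cvgB => //; exact: cvg_cst.
  by rewrite mul0r in c2; rewrite -[X in _ --> X]addr0; exact: cvgD c1 c2.
apply/cvgrPdist_le => e e0; near=> n.
have wn0 : 0 < w n.
  by near: n; move/cvgrPdist_lt : wcvg => /(_ _ w0_gt0); apply: filterS => n; rewrite ltr_norml ltrBlDr ltrDl => /andP[].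
have le_l : l n <= (Mn n)^-1 * log_ratio (ldlmx (An n) (xn n)) U.
  have pT := pd_ldlmx (xn n) (aAn n).1.
  rewrite /l -mulr_sumr -mulrDr ler_pM2l ?invr_gt0//.
  rewrite log_ratioB// addrA lerD2r.
  have ed i : 0 < map_mx (@expR R) (xn n) 0 i by rewrite mxE expR_gt0.
  have dn0 : \det (rowsub f (An n *m X)) != 0.
    by apply: contraTneq wn0 => d0; rewrite /w d0 mulr0 -(rmorph0 iota) re_real_scalar ltxx.
  have := det_rowsub_le fi ed dn0; rewrite -/(ldlmx _ _) -gram_detE//.
  rewrite -conj_scalarM -[conj_scalar _ _ _ * _]real_scalar_re; last first.
    by rewrite rmorphM conj_scalarK mulrC.
  rewrite -/(w n) -rmorphM ler_real_scalar => le.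
  have -> : \sum_i xn n 0 (f i) = ln (\prod_i map_mx (@expR R) (xn n) 0 (f i)).
    rewrite -[LHS]expRK expR_sum; congr ln.
    by apply: eq_bigr => i _; rewrite mxE.
  have p0 : 0 < \prod_i map_mx (@expR R) (xn n) 0 (f i) by rewrite prodr_gt0.
  by rewrite -lnM ?posrE// ler_ln ?posrE ?mulr_gt0// gram_det_gt0.
have ln_ge : b - e <= l n.
  apply: le_trans (lerB bd (lexx e)) _; rewrite lerBlDr -lerBlDl.
  apply: le_trans (ler_norm _) _; apply: ltW; near: n.
  by move/cvgrPdist_lt : lcvg; apply.
rewrite distrC ler_norml; apply/andP; split.
  rewrite lerBrDr addrC le_min (le_trans ln_ge)// lerBlDr lerDl ltW//.
by rewrite lerBlDr ge_min lerDr (ltW e0) orbT.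
Unshelve. all: by end_near. Qed.

Lemma mx_cvg_ldlmx (An : nat -> 'M[F]_m) (xn : nat -> 'rV[R]_m) A x :
  mx_cvg \oo An A -> (forall i, xn n 0 i @[n --> \oo] --> x 0 i) ->
  mx_cvg \oo (fun n => ldlmx (An n) (xn n)) (ldlmx A x).
Proof.
move=> AnA xnx; apply: mx_cvgM => //; apply: mx_cvgM; first exact: mx_cvg_adj.
apply: mx_cvg_diag => i; rewrite mxE; under eq_fun do rewrite mxE.
exact: cvg_comp (xnx i) (@continuous_expR R _).
Qed.

Lemma cvg_norm_det (An : nat -> 'M[F]_m) A : (forall n, `|\det (An n)| = 1) ->
  mx_cvg \oo An A -> `|\det A| = 1.
Proof.
move=> dAn /cvg_det/cvg_norm.
have -> : (fun n => `|\det (An n)|) = (fun=> 1) by apply/funext => n; rewrite dAn.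
by move=> dA; apply: (cvg_unique (@norm_hausdorff _ F) dA); exact: cvg_cst.
Qed.

Lemma admissible_subsequence (An : nat -> 'M[F]_m) (yn : nat -> 'rV[R]_m) (c : R) :
  (forall n, admissible (An n)) -> (forall n i, `|yn n 0 i| <= c) ->
  exists f : nat -> nat, exists (A : 'M[F]_m) (y : 'rV[R]_m),
  [/\ forall n, (n <= f n)%N, mx_cvg \oo (An \o f) A, `|\det A| = 1 &
      forall i, yn (f n) 0 i @[n --> \oo] --> y 0 i].
Proof.
(* One constant has to bound both the entries of the factors, by 1, and those of the vectors, by
   [c]. *)
move=> aAn yc; pose c1 := Num.max c 1.
have [||f [B [z [fn cA cy]]]] := @scalar_family_subsequence R k ('I_m * 'I_m)%type 'I_m
  (fun n ij => An n ij.1 ij.2) (fun n j => yn n 0 j) c1.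
- move=> n i; apply: le_trans ((aAn n).2 _ _) _.
  by rewrite -(rmorph1 iota) ler_real_scalar le_max lexx orbT.
- by move=> n j; rewrite le_max yc.
have cA' : mx_cvg \oo (An \o f) (\matrix_(i, j) B (i, j)).
  by move=> i j; rewrite mxE; exact: (cA (i, j)).
exists f, (\matrix_(i, j) B (i, j)), (\row_j z j); split => //.
  by apply: cvg_norm_det cA' => n; exact: (aAn _).1.
by move=> i; rewrite mxE; exact: cy.
Qed.

Variable P : probability GB R.
Hypothesis dim_condition : forall V : {vspace 'cV[F]_m}, V != 0%VS -> V != fullv ->
    \int[P]_U (\dim (grass_vspace U :&: V))%:R < r%:R / m%:R * (\dim V)%:R :> R.
Local Notation L := (mean_log_ratio P).

(** Summation by parts for [\sum_i d 0 i = 0], multiplied by [r / m], is subtracted from the mean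
    slope. What remains is the sum of the gaps weighted by the margins in the dimension condition
    for the flag, whose members here have dimensions from 1 to [m.-1]. *)
Lemma slope_expectation_gt0 d A : A \in unitmx -> row_sorted d ->
  \sum_i d 0 i = 0 -> d != 0 -> 0 < \int[P]_U slope d A U.
Proof.
move=> uA sd sumd d0.
have bD j : bounded_measurable (fun U : GB =>
    r%:R + -1 * (\dim (grass_vspace U :&: flag A j))%:R : R).
  apply: bounded_measurableD; first exact: bounded_measurable_cst.
  exact/bounded_measurableZ/dim_cap_bounded_measurable.
have bS (j : 'I_m.-1) : bounded_measurable (fun U : GB => (row_nth d j.+1 - row_nth d j) *
    (r%:R + -1 * (\dim (grass_vspace U :&: flag A j.+1))%:R)).
  exact: bounded_measurableZ.
pose I j : R := \int[P]_U (\dim (grass_vspace U :&: flag A j))%:R.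
have -> : \int[P]_U slope d A U = r%:R * row_nth d 0 +
    \sum_(j < m.-1) (row_nth d j.+1 - row_nth d j) * (r%:R - I j.+1).
  rewrite expectationD; [|exact: bounded_measurable_cst|exact: bounded_measurable_sum].
  rewrite expectation_cst expectation_sum//; congr (_ + _); apply: eq_bigr => j _.
  rewrite expectationZ// expectationD ?expectation_cst ?expectationZ ?mulN1r//.
  - exact: dim_cap_bounded_measurable.
  - exact: bounded_measurable_cst.
  - exact/bounded_measurableZ/dim_cap_bounded_measurable.
have := abel_row d (fun i => i); rewrite sumd card_ord.
under eq_bigr do rewrite card_ord_ge.
move=> e0; have {}e0 : r%:R * row_nth d 0 +
    \sum_(j < m.-1) (row_nth d j.+1 - row_nth d j) * (r%:R / m%:R * (m - j.+1)%:R) = 0.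
  have := congr1 (fun z => r%:R / m%:R * z) e0; rewrite mulr0 mulrDr mulrA divfK ?pnatr_eq0 -?lt0n//.
  by move=> e1; rewrite [RHS]e1; congr (_ + _); rewrite mulr_sumr; apply: eq_bigr => j _; rewrite mulrCA.
rewrite -[X in X < _]e0 ltrD2l.
have gap j : 0 <= row_nth d (j : 'I_m.-1).+1 - row_nth d j by exact: row_sorted_gap.
have jm (j : 'I_m.-1) : (j.+1 < m)%N by rewrite -ltn_predRL.
have lt (j : 'I_m.-1) : r%:R / m%:R * (m - j.+1)%:R < r%:R - I j.+1.
  have dj := dim_flag uA (ltnW (jm j)).
  have := dim_condition (V := flag A j.+1); rewrite -/(I j.+1) dj => h.
  rewrite natrB ?(ltnW (jm j))// mulrBr divfK ?pnatr_eq0 -?lt0n// ltrD2l ltrN2.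
  apply: h; first by rewrite -dimv_eq0 dj.
  by apply/eqP => VF; have := jm j; rewrite -{1}dj VF dim_colvec ltnn.
(* Without a gap [d] would be constant, hence 0 because its entries sum to 0. *)
have [j gj] : exists j : 'I_m.-1, row_nth d j.+1 - row_nth d j != 0.
  apply/existsP; rewrite -negb_forall; apply: contra d0 => /forallP gap0.
  have dc i : d 0 i = row_nth d 0.
    have := abel_row d (fun _ : 'I_1 => i); rewrite big_ord1 card_ord mul1r => ->.
    by rewrite big1 ?addr0// => j _; rewrite (eqP (gap0 j)) mul0r.
  apply/eqP/rowP => i; rewrite [RHS]mxE dc; move: sumd.
  under eq_bigr do rewrite dc; rewrite sumr_const card_ord => /eqP.
  by rewrite mulrn_eq0 (gtn_eqF m_gt0) => /eqP.
rewrite (bigD1 j)//= [X in _ < X](bigD1 j)//=; apply: ltr_leD.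
  by rewrite ltr_pM2l ?lt// lt0r gj gap.
by apply: ler_sum => i _; rewrite ler_wpM2l// ltW.
Qed.

Lemma coercive C : exists K, forall A x, admissible A -> \sum_i x 0 i = 0 ->
  L (ldlmx A x) <= C -> \sum_i `|x 0 i| <= K.
Proof.
apply: contrapT => /forallNP H.
have /choice[Ax HAx] (n : nat) : exists Ax : 'M[F]_m * 'rV[R]_m,
    [/\ admissible Ax.1, \sum_i Ax.2 0 i = 0, L (ldlmx Ax.1 Ax.2) <= C &
    n.+1%:R < \sum_i `|Ax.2 0 i|].
  have /existsNP[A /existsNP[x]] := H n.+1%:R.
  move=> /not_implyP[aA /not_implyP[sx /not_implyP[LC /negP]]].
  by rewrite -ltNge => lt; exists (A, x).
pose M n := \sum_i `|(Ax n).2 0 i|.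
have M_gt n : n.+1%:R < M n by have [] := HAx n.
have M0 n : 0 < M n by apply: le_lt_trans (M_gt n); rewrite ler0n.
pose yn n := (M n)^-1 *: (Ax n).2.
have [||f [A [y [fn AA dA yy]]]] := @admissible_subsequence (fun n => (Ax n).1) yn 1.
- by move=> n; have [] := HAx n.
- move=> n i; rewrite mxE normrM normfV (gtr0_norm (M0 n)) ler_pdivrMl// mulr1.
  by rewrite /M (bigD1 i)//= lerDl sumr_ge0.
have sumy : \sum_i y 0 i = 0.
  have : \sum_i yn (f n) 0 i @[n --> \oo] --> \sum_i y 0 i.
    by apply: cvg_big => [|i _]; [exact: add_continuous|exact: yy].
  have -> : (fun n => \sum_i yn (f n) 0 i) = fun=> 0.
    apply/funext => n; under eq_bigr do rewrite mxE; rewrite -mulr_sumr.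
    by have [_ -> _ _] := HAx (f n); rewrite mulr0.
  by move=> c1; apply: (cvg_unique (@Rhausdorff R) c1); exact: cvg_cst.
have y0 : y != 0.
  have s1 : \sum_i `|y 0 i| = 1.
    have : \sum_i `|yn (f n) 0 i| @[n --> \oo] --> \sum_i `|y 0 i|.
      by apply: cvg_big => [|i _]; [exact: add_continuous|apply: cvg_norm; exact: yy].
    have -> : (fun n => \sum_i `|yn (f n) 0 i|) = fun=> 1.
      apply/funext => n.
      under eq_bigr do rewrite mxE normrM normfV (gtr0_norm (M0 _)).
      by rewrite -mulr_sumr mulVf// lt0r_neq0.
    by move=> c1; apply: (cvg_unique (@Rhausdorff R) c1); exact: cvg_cst.
  apply/eqP => y0; move: s1; rewrite y0 big1 => [/esym/eqP|i _]; last by rewrite mxE normr0.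
  by rewrite oner_eq0.
(* Only the limit direction is sorted. The same permutation is applied to all factors and exponents
   of the sequence, which leaves the matrices unchanged. *)
have [s sy] := sorting_perm y.
pose A' := row_perm s A; pose d := col_perm s y.
have sd : row_sorted d by move=> i j ij; rewrite !mxE; exact: sy.
have sumd : \sum_i d 0 i = 0.
  by rewrite -[RHS]sumy [RHS](reindex_inj (@perm_inj _ s)); apply: eq_bigr => i _; rewrite mxE.
have d0 : d != 0.
  apply: contra y0 => /eqP d0; apply/eqP/rowP => i; rewrite [RHS]mxE.
  by have := congr1 (fun v : 'rV_m => v 0 (s^-1%g i)) d0; rewrite !mxE permKV.
have uA' : A' \in unitmx.
  rewrite /A' unitmxE unitfE -normr_eq0 row_permE det_mulmx normrM dA mulr1 det_perm.
  by rewrite normrX normrN normr1 expr1n oner_eq0.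
have := slope_expectation_gt0 uA' sd sumd d0; apply/negP; rewrite -leNgt.
pose An n := row_perm s (Ax (f n)).1; pose xn n := col_perm s (Ax (f n)).2.
pose u n (U : GB) := (M (f n))^-1 * log_ratio (ldlmx (An n) (xn n)) U.
have TE n : ldlmx (An n) (xn n) = ldlmx (Ax (f n)).1 (Ax (f n)).2 by exact: ldlmx_perm.
have aAn n : admissible (An n) by apply: admissible_perm; have [] := HAx (f n).
have bu n : bounded_measurable (u n).
  by apply/bounded_measurableZ/log_ratio_bounded_measurable/pd_ldlmx; exact: (aAn n).1.
have M_oo : (M (f n))^-1 @[n --> \oo] --> 0.
  apply: (@squeeze_cvgr _ _ _ _ (fun=> 0) (@harmonic R)); last 2 first.
  - exact: cvg_cst.
  - exact: cvg_harmonic.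
  apply: nearW => n; rewrite invr_ge0 (ltW (M0 _)) /= lef_pV2 ?posrE//.
  by apply: le_trans (ltW (M_gt _)); rewrite ler_nat ltnS.
have [c c0 cb] := @log_ratio_ldlmx_bound R k m r rm.
have u_le n U : `|u n U| <= r%:R * (1 + c).
  rewrite normrM gtr0_norm ?invr_gt0// ler_pdivrMl//.
  apply: le_trans (cb _ (xn n) (M (f n)) (aAn n) _ U) _.
    move=> i; rewrite mxE /M (bigD1 (s i))//= lerDl sumr_ge0//.
  rewrite mulrCA ler_wpM2l ?ler0n// mulrDr mulr1 lerD2l ler_peMl//.
  by apply: le_trans (ltW (M_gt _)); rewrite ler1n.
have [mb [b0 bb]] := slope_bounded_measurable d A'.
have minb n : bounded_measurable (fun U => Num.min (u n U) (slope d A' U)).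
  by apply: bounded_measurable_min => //; exact: slope_bounded_measurable.
have minc : \int[P]_U Num.min (u n U) (slope d A' U) @[n --> \oo] -->
    \int[P]_U slope d A' U.
  apply: (@bounded_cvg_expectation _ _ _ P
    (fun n U => Num.min (u n U) (slope d A' U)) _ (Num.max (r%:R * (1 + c)) b0)).
  + by move=> n; exact: (minb n).1.
  + exact: slope_bounded_measurable.
  + move=> n U; rewrite le_max; apply/orP.
    by rewrite /Num.min; case: ifP => _; [left|right].
  + move=> U; have [g [gi g0 gd]] := slope_le U uA' sd.
    apply: (growth_rate aAn (fun n => M0 (f n)) M_oo _ _ gi g0 gd).
      by move=> i j; rewrite mxE; under eq_fun do rewrite mxE; exact: AA.
    move=> i; rewrite mxE; have := yy (s i); under eq_fun do rewrite mxE.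
    by under [in X in _ -> X]eq_fun do rewrite mxE.
(* The means of the log-ratios stay below [C], so after division by [M (f n)] their upper bound
   tends to 0, against the positive mean slope. *)
apply: (ler_cvg_to minc (g := fun n => (M (f n))^-1 * `|C|)).
  by rewrite -(mul0r `|C|); apply: cvgM => //; exact: cvg_cst.
- apply: nearW => n; apply: (@le_trans _ _ (\int[P]_U u n U)).
    by apply: le_expectation => // U; rewrite ge_min lexx.
  rewrite expectationZ; last first.
    by apply/log_ratio_bounded_measurable/pd_ldlmx; exact: (aAn n).1.
  rewrite ler_pM2l ?invr_gt0// TE; apply: le_trans (ler_norm C).
  by have [] := HAx (f n).
Qed.

Lemma mean_minimizer_exists : exists T, mean_minimizer P T.
Proof.
pose C := L 1%:M; have [K KC] := coercive C.
have p1 : Pos (1%:M : 'M[F]_m) by apply/PosE; split; [exact: pd1|exact: det1].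
have [c c0 cb] := @log_ratio_ldlmx_bound R k m r rm.
have ldl T : Pos T -> L T <= C -> exists Ax : 'M[F]_m * 'rV[R]_m,
    [/\ T = ldlmx Ax.1 Ax.2, admissible Ax.1, \sum_i Ax.2 0 i = 0 &
        forall i, `|Ax.2 0 i| <= K].
  move=> /PosE[pT dT] TC; have [A [x [aA TE]]] := pd_ldlmx_exists pT.
  exists (A, x); have sx : \sum_i x 0 i = 0.
    apply: expR_inj; rewrite expR0; apply: (fmorph_inj iota).
    by rewrite -(det_ldlmx _ aA.1) -TE dT rmorph1.
  split => // i; apply: le_trans (KC A x aA sx _); last by rewrite -TE.
  by rewrite (bigD1 i)//= lerDl sumr_ge0.
(* Only values up to that of the identity matrix are considered, since coercivity bounds the
   exponents there. *)
pose S := [set L T | T in [set T | Pos T /\ L T <= C]].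
have infS : has_inf S.
  split; first by exists C, 1%:M.
  exists (- (r%:R * (K + c))) => _ [T [pT TC] <-].
  have [[A x] [/= TE aA sx xK]] := ldl T pT TC.
  rewrite -(expectation_cst P (- _)); apply: le_expectation.
  - exact: bounded_measurable_cst.
  - by apply: log_ratio_bounded_measurable; case/PosE: pT.
  - by move=> U; have := cb A x K aA xK U; rewrite -TE ler_norml => /andP[].
have /choice[Ax HAx] (n : nat) : exists Ax : 'M[F]_m * 'rV[R]_m,
    [/\ admissible Ax.1, \sum_i Ax.2 0 i = 0, forall i, `|Ax.2 0 i| <= K &
        L (ldlmx Ax.1 Ax.2) <= inf S + n.+1%:R^-1].
  have [|_ [T [pT TC] <-] lt] := @inf_adherent _ S n.+1%:R^-1 _ infS.
    by rewrite invr_gt0 ltr0n.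
  have [[A x] [/= TE aA sx xK]] := ldl T pT TC.
  exists (A, x); split; [exact: aA|exact: sx|exact: xK|].
  by rewrite -[ldlmx _ _]/(ldlmx A x) -TE; exact: ltW.
have [||f [A [x [fn AA dA xx]]]] :=
  @admissible_subsequence (fun n => (Ax n).1) (fun n => (Ax n).2) K.
- by move=> n; have [] := HAx n.
- by move=> n i; have [_ _ + _] := HAx n; exact.
have pT := pd_ldlmx x dA.
have sx : \sum_i x 0 i = 0.
  have : \sum_i (Ax (f n)).2 0 i @[n --> \oo] --> \sum_i x 0 i.
    by apply: cvg_big => [|i _]; [exact: add_continuous|exact: xx].
  have -> : (fun n => \sum_i (Ax (f n)).2 0 i) = fun=> 0.
    by apply/funext => n; have [_ -> _ _] := HAx (f n).
  by move=> c1; apply: (cvg_unique (@Rhausdorff R) c1); exact: cvg_cst.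
have Lcvg : L (ldlmx (Ax (f n)).1 (Ax (f n)).2) @[n --> \oo] --> L (ldlmx A x).
  have pTn n : pdmx (ldlmx (Ax (f n)).1 (Ax (f n)).2).
    by apply: pd_ldlmx; have [[]] := HAx (f n).
  apply: (@bounded_cvg_expectation _ _ _ _ _ _ (r%:R * (K + c))).
  - by move=> n; exact: (log_ratio_bounded_measurable rm (pTn n)).1.
  - exact: log_ratio_bounded_measurable.
  - by move=> n U; apply: cb; have [] := HAx (f n).
  - move=> U; have rU := rank_basis_mx U.
    have gcvg : gram_det (ldlmx (Ax (f n)).1 (Ax (f n)).2) (basis_mx U) @[n --> \oo] -->
        gram_det (ldlmx A x) (basis_mx U).
      have Tcvg := mx_cvg_ldlmx AA xx.
      have cX : mx_cvg \oo (fun=> basis_mx U) (basis_mx U) by exact: mx_cvg_cst.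
      have dcvg : \det ((basis_mx U)^H *m ldlmx (Ax (f n)).1 (Ax (f n)).2 *m
          basis_mx U) @[n --> \oo] --> \det ((basis_mx U)^H *m ldlmx A x *m basis_mx U).
        by apply: cvg_det; apply: mx_cvgM => //; apply: mx_cvgM => //; exact: mx_cvg_adj.
      exact: cvg_comp dcvg (@re_scalar_continuous R k _).
    have qcvg : gram_det (ldlmx (Ax (f n)).1 (Ax (f n)).2) (basis_mx U) /
        gram_det 1%:M (basis_mx U) @[n --> \oo] -->
        gram_det (ldlmx A x) (basis_mx U) / gram_det 1%:M (basis_mx U).
      by apply: cvgM => //; exact: cvg_cst.
    exact: cvg_comp qcvg (continuous_ln (gram_ratio_gt0 pT rU)).
have posT : Pos (ldlmx A x).
  by apply/PosE; split => //; rewrite det_ldlmx// sx expR0 rmorph1.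
have Linf : L (ldlmx A x) <= inf S.
  apply: (ler_cvg_to Lcvg (g := fun n => inf S + n.+1%:R^-1)).
    rewrite -[X in _ --> X]addr0; apply: cvgD; first exact: cvg_cst.
    exact: cvg_harmonic.
  apply: nearW => n; have [_ _ _] := HAx (f n) => /le_trans; apply.
  by rewrite lerD2l lef_pV2 ?posrE ?ltr0n// ler_nat ltnS.
exists (ldlmx A x); split; first exact: posT.
move=> T posT'; apply: le_trans Linf _.
(* Above the level [C], the identity matrix, which belongs to the sublevel set, takes the place of
   [T]. *)
have [TC|CT] := leP (L T) C.
  by apply: ge_inf; [exact: infS.2|exists T].
apply: le_trans (ltW CT); apply: ge_inf; first exact: infS.2.
by exists 1%:M.
Qed.

End coercivity.

Theorem theorem1 (R : realType) (k : scalars) (m r : nat)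
    (r_gt0 : (0 < r)%N) (r_lt_m : (r < m)%N)
    (P : probability (grass_borel R k m r (ltnW r_lt_m)) R) :
  (exists! S : 'M[scalar_field R k]_m, is_GE P S) <->
  (forall V : {vspace 'cV[scalar_field R k]_m}, V != 0%VS -> V != fullv ->
    (\int[P]_U (\dim (grass_vspace U :&: V))%:R%:E
      < (r%:R / m%:R * (\dim V)%:R)%:E)%E).
Proof.
have m_gt0 : (0 < m)%N := leq_ltn_trans (leq0n r) r_lt_m.
have GE := is_GE_minimizer m_gt0 P.
have bd := dim_cap_bounded_measurable (ltnW r_lt_m).
split=> [[S [geS uniqS]] V V0 VF|dimP].
  rewrite EFin_expectation; last exact: bd.
  rewrite lte_fin; apply: (mean_minimizer_unique_strict m_gt0 r_lt_m _ _ V0 VF).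
    exact/GE/geS.
  move=> T minT; have geT : is_GE P (invmx T) by apply/GE; rewrite invmxK.
  by rewrite (uniqS _ geT) invmxK.
have {}dimP (V : {vspace 'cV[scalar_field R k]_m}) : V != 0%VS -> V != fullv ->
    \int[P]_U (\dim (grass_vspace U :&: V))%:R < r%:R / m%:R * (\dim V)%:R :> R.
  by move=> V0 VF; rewrite -lte_fin -EFin_expectation; [exact: dimP|exact: bd].
have [T minT] := mean_minimizer_exists m_gt0 dimP.
exists (invmx T); split; first by apply/GE; rewrite invmxK.
move=> S /GE minS; apply: (can_inj (@invmxK _ _)); rewrite invmxK.
exact: (mean_minimizer_unique m_gt0 dimP minT minS).
Qed.
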